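(* For every partition $\lambda$, \[ g_\lambda(x;\alpha,\beta)=\sum_{T\in\mathrm{MRPP}(\lambda)}\mathrm{wt}(T). \]
   Context: Indeterminates $x=(x_1,x_2,\dots)$, $\alpha=(\alpha_i)$, $\beta=(\beta_i)$; $A_m=\alpha_1+\dots+\alpha_m$, $B_m=\beta_1+\dots+\beta_m$ ($=0$ for $m\le0$). For a formal $\mathbb Z$-linear combination $Z=\sum_vc_vv$ of finitely many indeterminates, $h_m[Z]$ is the coefficient of $t^m$ in $\prod_v(1-vt)^{-c_v}$. For a partition $\lambda$ with at most $n$ parts (padded with zeros), \[ g_\lambda(x_n;\alpha,\beta)=\frac{\det\big(h_{\lambda_i+n-i}[x_j-A_{\lambda_i-1}+B_{i-1}]\big)_{1\le i,j\le n}}{\prod_{1\le i<j\le n}(x_i-x_j)}, \] and $g_\lambda(x;\alpha,\beta)$ denotes the formal power series in $x_1,x_2,\dots$ whose specialization $x_i=0$ for $i>n$ equals $g_\lambda(x_n;\alpha,\beta)$ for every $n\ge\ell(\lambda)$. A reverse plane partition of shape $\lambda$ is a filling $T$ of the cells $(i,j)$, $1\le j\le\lambda_i$, with positive integers weakly increasing along rows and columns. A (left-)marked reverse plane partition is such a $T$ in which each entry $T(i,j)$ such that $(i,j+1)$ is a cell and $T(i,j)=T(i,j+1)$ may be marked; $\mathrm{MRPP}(\lambda)$ is the set of these. Its weight is $\mathrm{wt}(T)=\prod_{(i,j)}w(i,j)$ where $w(i,j)=-\alpha_j$ if $T(i,j)$ is marked; $w(i,j)=\beta_{i-1}$ if $T(i,j)$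 is unmarked, $(i-1,j)$ is a cell, and $T(i,j)=T(i-1,j)$ as integers; and $w(i,j)=x_{T(i,j)}$ otherwise. *)

(* Defs.v *)
From mathcomp Require Import all_boot all_order all_algebra.
From mathcomp Require Import finmap.
From mathcomp.multinomials Require Import monalg.

Set Implicit Arguments.
Unset Strict Implicit.
Unset Printing Implicit Defensive.

Import GRing.Theory.

Local Open Scope ring_scope.

(** ** Indeterminates *)

(* The three families x_1, x_2, ... / alpha_1, alpha_2, ... / beta_1, ...
   are each indexed by the positive integers; the [k]-th element of each copy
   of [nat] below stands for the indeterminate of index [k + 1].  The functions
   [xi], [al], [be] take the 1-based index. *)
Notation indet := (nat + (nat + nat))%type.

Definition xi (i : nat) : indet := inl i.-1.
Definition al (i : nat) : indet := inr (inl i.-1).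
Definition be (i : nat) : indet := inr (inr i.-1).

(* Z[alpha, beta] *)
Definition coefring : comNzRingType := {malg int[{cmonom (nat + nat)%type}]}.

(* Z[alpha, beta][x_1, x_2, ...] *)
Definition polring : comNzRingType := {malg coefring[{cmonom nat}]}.

Definition var (v : indet) : polring :=
  match v with
  | inl k => << ucm k >>
  | inr ab => malgC (<< ucm ab >> : coefring)
  end.

(** ** The polynomials h_m[Z] *)

(* [ipow1 m v c] represents (1 - v t)^(-c) modulo t^(m+1), the variable of the
   polynomials being t: modulo t^(m+1), the inverse of 1 - v t is the truncated
   geometric series (see [geomE]). *)
Definition geom (m : nat) (v : polring) : {poly polring} :=
  \poly_(k < m.+1) v ^+ k.

Definition ipow1 (m : nat) (v : polring) (c : int) : {poly polring} :=
  match c with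
  | Posz n => geom m v ^+ n
  | Negz n => (1 - v *: 'X) ^+ n.+1
  end.

Lemma geomE (m : nat) (v : polring) :
  (1 - v *: 'X) * geom m v = 1 - (v *: 'X) ^+ m.+1.
Proof.
rewrite -[RHS]opprB subrX1 -mulNr opprB; congr (_ * _).
by rewrite /geom poly_def; apply: eq_bigr => k _; rewrite exprZn.
Qed.

(* Formal Z-linear combinations of indeterminates are the elements of the free
   Z-module {malg int[indet]}; the coefficient of v in Z is [Z@_v]. *)
Definition h (m : nat) (Z : {malg int[indet]}) : polring :=
  (\prod_(v <- msupp Z) ipow1 m (var v) Z@_v)`_m.

Definition A (m : nat) : {malg int[indet]} := \sum_(1 <= k < m.+1) << al k >>.
Definition B (m : nat) : {malg int[indet]} := \sum_(1 <= k < m.+1) << be k >>.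

(** ** Partitions and the symmetric polynomials g_lambda(x_n; alpha, beta) *)

(* A partition is the sequence of its positive parts, so that its length is
   its [size]. *)
Definition is_part (lam : seq nat) : bool := sorted geq lam && (0 \notin lam)%N.

(* The i-th part, i >= 1, after padding with zeros. *)
Definition part (lam : seq nat) (i : nat) : nat := nth 0%N lam i.-1.

(* For a zero part, [(part lam i).-1] is 0 instead of -1, but A_0 = A_(-1). *)
Definition g_entry (lam : seq nat) (n i j : nat) : polring :=
  h (part lam i + n - i) (<< xi j >> - A (part lam i).-1 + B i.-1).

Definition g_num (lam : seq nat) (n : nat) : polring :=
  \det (\matrix_(i < n, j < n) g_entry lam n i.+1 j.+1).

Definition g_den (n : nat) : polring :=
  \prod_(i < n) \prod_(j < n | (i < j)%N) (var (xi i.+1) - var (xi j.+1)).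

Definition is_quotient (R : comNzRingType) (p d q : R) : Prop :=
  unique (fun q' => q' * d = p) q.

Definition is_g_poly (lam : seq nat) (n : nat) (g : polring) : Prop :=
  is_quotient (g_num lam n) (g_den n) g.

(** ** Formal power series in x_1, x_2, ... over Z[alpha, beta] *)

Definition fps : Type := {cmonom nat} -> coefring.

Definition fps_of (p : polring) : fps := fun m => p@_m.

(* The specialization x_i = 0 for i > n. *)
Definition fps_trunc (n : nat) (G : fps) : fps :=
  fun m => if all (fun k => (k < n)%N) (finsupp m) then G m else 0.

(* G is the sum of the possibly infinite family F: every monomial occurs in
   finitely many members of the family. *)
Definition is_fps_sum (I : eqType) (F : I -> fps) (G : fps) : Prop :=
  forall m, exists s : seq I,
    [/\ uniq s, forall i, F i m != 0 -> i \in s & G m = \sum_(i <- s) F i m].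

Definition is_g_series (lam : seq nat) (G : fps) : Prop :=
  forall n, (size lam <= n)%N ->
    exists2 g : polring, is_g_poly lam n g & fps_trunc n G =1 fps_of g.

(** ** Marked reverse plane partitions *)

Definition cell (lam : seq nat) : finType :=
  {c : 'I_(size lam) * 'I_(head 0%N lam) | (c.2 < nth 0 lam c.1)%N}.

Section MarkedReversePlanePartitions.
Variable lam : seq nat.
Implicit Types (c d : cell lam) (T : {ffun cell lam -> nat}).

Definition cell_row c : nat := (val c).1.+1.
Definition cell_col c : nat := (val c).2.+1.

Definition is_rpp T : bool :=
  [&& [forall c, 0 < T c],
      [forall c, forall d, (cell_row c == cell_row d)
                           && (cell_col c <= cell_col d) ==> (T c <= T d)]
    & [forall c, forall d, (cell_col c == cell_col d)
                           && (cell_row c <= cell_row d) ==> (T c <= T d)]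
  ]%N.

(* The cell to the right of c, resp. above c, exists and has the same entry. *)
Definition eq_right T c : bool :=
  [exists d, [&& cell_row d == cell_row c, cell_col d == (cell_col c).+1 & T d == T c]].
Definition eq_above T c : bool :=
  [exists d, [&& (cell_row d).+1 == cell_row c, cell_col d == cell_col c & T d == T c]].

(* A filling together with its set of marked cells. *)
Definition mrpp : eqType :=
  {T : {ffun cell lam -> nat} * {set cell lam}
     | is_rpp T.1 && [forall c in T.2, eq_right T.1 c]}.

Definition wt_cell (T : mrpp) c : polring :=
  if c \in (val T).2 then - var (al (cell_col c))
  else if eq_above (val T).1 c then var (be (cell_row c).-1)
  else var (xi ((val T).1 c)).

Definition wt (T : mrpp) : polring := \prod_(c : cell lam) wt_cell T c.

End MarkedReversePlanePartitions.

(* Main.v *)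
Require Import Defs.
From mathcomp Require Import all_boot all_order all_algebra.
From mathcomp Require Import finmap zify ring.
From mathcomp.multinomials Require Import monalg.
From Stdlib Require Import FunctionalExtensionality.

(**
  Both sides satisfy the same recursion on the number of variables.

  Multiplying the matrix of the coefficients of [h_m[X_n - A + B]] by that of
  the coefficients of [\prod_(l != j) (s - x_l)], whose determinant is the
  Vandermonde product, turns the bialternant into the Jacobi-Trudi determinant
  [det (h_(lam_i - i + k)[X_n - A_(lam_i - 1) + B_(i - 1)])].  With [s = 1 / t]
  and [alpha_0 = 0], the row of index [i] of this determinant is read off the
  expansion at [s = oo] of
    [phi_(i,m) = s^-1 \prod_(k < m) (s - alpha_k) / \prod_(k < i) (s - beta_k)]
  at [m = lam_i], multiplied by the generating series of [X_n].

  A new variable [x] multiplies every row by [s / (s - x)].  Expanding the rows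
  from top to bottom, and using
    [phi_(i,m) = phi_(i+1,m+1) + (alpha_m - beta_i) phi_(i+1,m)]
  to eliminate from row [i + 1] the multiples of the vectors already present
  in row [i], gives a sum over the partitions [mu] contained in [lam], whose
  coefficient is the product over the cells of [lam / mu] of the weights these
  cells have in a marked reverse plane partition when they all carry the
  largest entry.  Removing the largest entry from a marked reverse plane
  partition gives the same recursion.
*)

Set Implicit Arguments.
Unset Strict Implicit.
Unset Printing Implicit Defensive.

Import GRing.Theory.

Local Open Scope ring_scope.

(** * Expansion of an alternating form along chains *)

Section ChainSum.
Variables (K : comNzRingType) (x : K) (a b : nat -> K).

(* The weight of the cells in columns [q + 1, ..., m] of row [i + 1] when they
   all carry the new entry, [p] being the number of cells of the row above that
   do not carry it; [row_weight] is 0-based, unlike the indices of [a], [b]. *)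
Definition row_weight (i p m q : nat) : K :=
  \prod_(q <= j < m)
    ((if (j < p)%N then x else b i) - (if (j.+1 < m)%N then a j.+1 else 0)).

(* The weighted sum of [G mu] over the sequences [mu] of length [i] such that
   [mu_k <= mu_(k-1)] and [mu_k <= lam_k], where [mu_(-1)] stands for [lam 0]. *)
Fixpoint chain_sum (lam : nat -> nat) (i : nat) (G : seq nat -> K) : K :=
  if i is i'.+1 then
    chain_sum lam i' (fun s =>
      \sum_(0 <= q < (minn (last (lam 0%N) s) (lam i')).+1)
        row_weight i' (last (lam 0%N) s) (lam i') q * G (rcons s q))
  else G [::].

Variable lam : nat -> nat.

Lemma chain_sumS i G :
  chain_sum lam i.+1 G =
  chain_sum lam i (fun s =>
    \sum_(0 <= q < (minn (last (lam 0%N) s) (lam i)).+1)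
      row_weight i (last (lam 0%N) s) (lam i) q * G (rcons s q)).
Proof. by []. Qed.

Lemma eq_chain_sum i G G' :
  (forall s, size s = i -> G s = G' s) -> chain_sum lam i G = chain_sum lam i G'.
Proof.
elim: i G G' => [|i IH] G G' eqG /=; first exact: eqG.
apply: IH => s szs; apply: eq_bigr => q _.
by rewrite eqG // size_rcons szs.
Qed.

Lemma chain_sum0 i : chain_sum lam i (fun=> 0) = 0.
Proof.
elim: i => [|i IH] //=; rewrite -[RHS]IH; apply: eq_chain_sum => s _.
by apply: big1 => q _; rewrite mulr0.
Qed.

Lemma chain_sumD i G G' :
  chain_sum lam i (fun s => G s + G' s) = chain_sum lam i G + chain_sum lam i G'.
Proof.
elim: i G G' => [|i IH] G G' //=; rewrite -IH; apply: eq_chain_sum => s _.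
by rewrite -big_split; apply: eq_bigr => q _; rewrite mulrDr.
Qed.

Lemma chain_sumZ i c G :
  chain_sum lam i (fun s => c * G s) = c * chain_sum lam i G.
Proof.
elim: i G => [|i IH] G //=; rewrite -IH; apply: eq_chain_sum => s _.
by rewrite mulr_sumr; apply: eq_bigr => q _; rewrite mulrCA.
Qed.

Lemma chain_sum_sum i (I : Type) (r : seq I) (G : I -> seq nat -> K) :
  chain_sum lam i (fun s => \sum_(j <- r) G j s) =
  \sum_(j <- r) chain_sum lam i (G j).
Proof.
elim: r => [|j r IH].
  rewrite big_nil -[RHS](chain_sum0 i); apply: eq_chain_sum => s _.
  by rewrite big_nil.
rewrite big_cons -IH -chain_sumD; apply: eq_chain_sum => s _.
by rewrite big_cons.
Qed.

Lemma row_weight_ge i p m q : (m <= q)%N -> row_weight i p m q = 1.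
Proof. by move=> mq; rewrite /row_weight big_geq. Qed.

Lemma row_weight_recl i p m q : (q < m)%N ->
  row_weight i p m q =
    ((if (q < p)%N then x else b i) - (if (q.+1 < m)%N then a q.+1 else 0))
    * row_weight i p m q.+1.
Proof. by move=> qm; rewrite /row_weight big_ltn. Qed.

End ChainSum.

(** * Alternating multilinear functions on lists of vectors *)

Section AlternatingExpansion.
Variables (K : comNzRingType) (V : lmodType K) (D : seq V -> K).
Hypothesis D_linear : forall s t c u v,
  D (s ++ (c *: u + v) :: t) = c * D (s ++ u :: t) + D (s ++ v :: t).
Hypothesis D_alternating : forall s t u, D (s ++ u :: u :: t) = 0.

Lemma altD s t u v : D (s ++ (u + v) :: t) = D (s ++ u :: t) + D (s ++ v :: t).
Proof. by rewrite -[u in LHS]scale1r D_linear mul1r. Qed.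

Lemma alt0 s t : D (s ++ 0 :: t) = 0.
Proof. by apply: (addrI (D (s ++ 0 :: t))); rewrite -altD !addr0. Qed.

Lemma altZ s t c u : D (s ++ (c *: u) :: t) = c * D (s ++ u :: t).
Proof. by rewrite -[c *: u]addr0 D_linear alt0 addr0. Qed.

Lemma alt_sum s t (I : Type) (r : seq I) (P : pred I) (F : I -> V) :
  D (s ++ (\sum_(i <- r | P i) F i) :: t) = \sum_(i <- r | P i) D (s ++ F i :: t).
Proof.
elim: r => [|i r IH]; first by rewrite !big_nil alt0.
by rewrite !big_cons; case: ifP => _ //; rewrite altD IH.
Qed.

(* In the application [v i m] is [phi i m / (s - x)]. *)
Variables (x : K) (a b : nat -> K) (phi v : nat -> nat -> V).
Hypothesis phiE : forall i m, phi i m = v i m.+1 - (x - a m) *: v i m.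
Hypothesis vE : forall i m,
  v i m = v i.+1 m.+1 + (a m - b i.+1) *: v i.+1 m.
Hypothesis v0 : forall i, v i 0%N = 0.
Variable lam : nat -> nat.
Hypothesis lam_anti : forall i, (lam i.+1 <= lam i)%N.

Local Notation R := (row_weight x a b).
Local Notation L := (chain_sum x a b lam).

Definition chain_rows (s : seq nat) : seq V :=
  mkseq (fun k => phi k (nth 0%N s k)) (size s).

Lemma chain_rows_rcons s q :
  chain_rows (rcons s q) = rcons (chain_rows s) (phi (size s) q).
Proof.
rewrite /chain_rows size_rcons mkseqS nth_rcons ltnn eqxx; congr rcons.
apply/eq_in_map => k; rewrite mem_iota add0n => /andP[_ ks].
by rewrite nth_rcons ks.
Qed.

(** For [q < r] the weight satisfies [R i p m q = (x - a q.+1) * R i p m q.+1], so [phiE] makes the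
    sum telescope; it starts at [v i 0 = 0]. *)
Lemma row_sum_small i p m r : (r <= p)%N -> (r < m)%N ->
  \sum_(0 <= q < r.+1) R i p m q *: phi i q = R i p m r *: v i r.+1.
Proof.
elim: r => [|r IH] rp rm; first by rewrite big_nat1 phiE v0 scaler0 subr0.
rewrite big_nat_recr //= IH; try lia.
rewrite (row_weight_recl _ _ _ _ _ (_ : r < m)%N); last lia.
rewrite rp rm phiE scalerBr scalerA mulrC.
by rewrite addrC subrK.
Qed.

(** The last cell has no right neighbour, hence weight [x] instead of [x - a m]. The result
    represents [s / (s - x)] times [phi i m], the row after insertion of the new variable. *)
Lemma row_sum_full i p m : (m <= p)%N ->
  \sum_(0 <= q < m.+1) R i p m q *: phi i q = phi i m + x *: v i m.
Proof.
case: m => [|m] mp.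
  by rewrite big_nat1 row_weight_ge // scale1r v0 scaler0 addr0.
rewrite big_nat_recr //= row_sum_small //; last lia.
rewrite row_weight_recl // mp ltnn subr0 !row_weight_ge // mulr1 scale1r.
by rewrite addrC.
Qed.

(** The weight of the columns [p + 1] to [m] when each of their cells lies below a cell with the new
    entry: [x] does not occur in it. *)
Local Notation Kw i m p := (R i p m p).

Lemma row_weight_le i p p' m q :
  (p <= q)%N -> (p' <= q)%N -> R i p m q = R i p' m q.
Proof.
move=> pq p'q; apply: eq_big_nat => j /andP[qj jm].
by rewrite !ltnNge (leq_trans pq qj) (leq_trans p'q qj).
Qed.

(** The cell weight [b i.+1 - a k.+1] is, up to sign, the coefficient in [vE]. *)
Lemma below_step i m k : (k.+1 < m)%N ->
  Kw i.+1 m k *: v i.+1 k.+1 =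
  Kw i.+1 m k.+1 *: v i.+1 k.+2 - Kw i.+1 m k.+1 *: v i k.+1.
Proof.
move=> km; rewrite row_weight_recl; last lia.
rewrite ltnn km (@row_weight_le _ k k.+1) //.
rewrite (vE i k.+1) scalerDr opprD addNKr scalerA -scaleNr; congr (_ *: _); ring.
Qed.

Lemma below_telescope i m p r : (p < r)%N -> (r <= m)%N ->
  Kw i.+1 m p *: v i.+1 p.+1 =
  Kw i.+1 m r.-1 *: v i.+1 r - \sum_(p.+1 <= k < r) Kw i.+1 m k *: v i k.
Proof.
elim: r => // r IH; rewrite ltnS leq_eqVlt => /orP[/eqP<- _|pr rm].
  by rewrite big_geq // subr0.
rewrite IH //; last lia.
case: r pr rm {IH} => // r pr rm; rewrite below_step //=.
rewrite [in RHS]big_nat_recr /= ?opprD -?addrA; last lia.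
congr (_ + _).
by rewrite addrC.
Qed.

(** Since [phi i.+1 m + x *: v i.+1 m = v i m + b i.+1 *: v i.+1 m], and [b i.+1] is the weight of
    the last cell, telescoping up to column [m] leaves only multiples of the [v i k]. *)
Lemma below_full i m p : (p < m)%N ->
  phi i.+1 m + x *: v i.+1 m - Kw i.+1 m p *: v i.+1 p.+1 =
  \sum_(p.+1 <= k < m.+1) Kw i.+1 m k *: v i k.
Proof.
move=> pm; rewrite (below_telescope _ pm) // big_nat_recr //=.
rewrite (row_weight_ge _ _ _ _ _ (leqnn m)) scale1r.
have -> : phi i.+1 m + x *: v i.+1 m = v i m + Kw i.+1 m m.-1 *: v i.+1 m.
  rewrite phiE (vE i m) row_weight_recl; last lia.
  rewrite ltnn (_ : m.-1.+1 = m) ?ltnn; last lia.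
  rewrite row_weight_ge // mulr1 subr0 -!addrA; congr (_ + _).
  rewrite -scaleNr -!scalerDl; congr (_ *: _); ring.
rewrite opprB addrC -addrA; congr (_ + _).
by rewrite addrC subrK.
Qed.

(** Here [p] will be the last part of a chain. Moving it from the bounds into an indicator makes the
    range independent of the chain, so that this sum can be exchanged with [chain_sum]. *)
Lemma sum_cut (F : nat -> V) n p :
  \sum_(1 <= k < n) (p < k)%N%:R *: F k = \sum_(p.+1 <= k < n) F k.
Proof.
have [np|pn] := leqP n p.+1.
  rewrite [RHS]big_geq // big_nat_cond big1 // => k /andP[/andP[_ kn] _].
  by rewrite ltnNge (_ : k <= p)%N ?scale0r //; lia.
rewrite (big_cat_nat (n := p.+1)) //=; last lia.
rewrite big_nat_cond big1 ?add0r => [|k /andP[/andP[_ kn] _]].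
  by apply: eq_big_nat => k /andP[pk _]; rewrite pk scale1r.
by rewrite ltnNge (_ : k <= p)%N ?scale0r //; lia.
Qed.

Lemma row_expand i p m :
  \sum_(0 <= q < (minn p m).+1) R i.+1 p m q *: phi i.+1 q =
  (phi i.+1 m + x *: v i.+1 m)
  - \sum_(1 <= k < m.+1) (p < k)%N%:R *: (Kw i.+1 m k *: v i k).
Proof.
rewrite sum_cut; have [pm|mp] := ltnP p m.
  by rewrite row_sum_small // -(below_full _ pm) subKr.
by rewrite row_sum_full // [X in _ - X]big_geq ?subr0.
Qed.

(** The value of [c] is irrelevant: its term is killed by alternation in [chain_sum_lt]. *)
Lemma row_expand_lt i p m r : (r <= m)%N ->
  exists c, \sum_(0 <= q < (minn p m).+1) (q < r)%N%:R *: (R i.+1 p m q *: phi i.+1 q)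
    = c *: v i.+1 r - \sum_(1 <= k < r) (p < k)%N%:R *: (Kw i.+1 m k *: v i k).
Proof.
case: r => [|r] rm.
  exists 0; rewrite scale0r [X in _ - X]big_geq // subr0.
  by rewrite big1 // => q _; rewrite scale0r.
rewrite sum_cut; have [rp|pr] := leqP r p.
  exists (R i.+1 p m r); rewrite [X in _ - X]big_geq // subr0 -row_sum_small //.
  rewrite (big_cat_nat (n := r.+1)) //=; last lia.
  rewrite [X in _ + X]big_nat_cond [X in _ + X]big1 ?addr0.
    by apply: eq_big_nat => q /andP[_ qr]; rewrite qr scale1r.
  by move=> q /andP[/andP[rq _] _]; rewrite ltnNge rq scale0r.
exists (Kw i.+1 m r); rewrite (_ : minn p m = p); last lia.
rewrite -(below_telescope _ _ rm); last lia.
rewrite -row_sum_small //; last lia.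
by apply: eq_big_nat => q qp; rewrite (_ : q < r.+1)%N ?scale1r //; lia.
Qed.

(* The invariant of the expansion: the partial sums over [mu_i < r] are
   multiples of [v i r], so that the terms [v i k] produced by [row_expand] in
   the next row do not contribute. *)
Lemma chain_sum_lt i r w : (r <= lam i)%N ->
  L i.+1 (fun s => (last (lam 0%N) s < r)%N%:R * D (chain_rows s ++ v i r :: w)) = 0.
Proof.
elim: i r w => [|i IH] r w rlam.
  rewrite /= minnn.
  under eq_bigr => q _.
    rewrite (_ : D _ = D ([::] ++ phi 0%N q :: v 0%N r :: w)) // mulrCA -!altZ; over.
  rewrite -(alt_sum [::]).
  case: r rlam => [|r] rlam.
    by rewrite big1 ?(alt0 [::]) // => q _; rewrite scale0r.
  rewrite (big_cat_nat (n := r.+1)) //=; last lia.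
  rewrite [X in _ + X]big_nat_cond [X in _ + X]big1 ?addr0 => [|q /andP[/andP[rq _] _]].
    under eq_big_nat => q /andP[_ qr] do rewrite qr scale1r.
    by rewrite row_sum_small ?(altZ [::]) ?(D_alternating [::]) ?mulr0 //; lia.
  by rewrite ltnNge rq scale0r.
rewrite chain_sumS.
under eq_chain_sum => s szs.
  under eq_bigr => q _.
    rewrite last_rcons chain_rows_rcons szs cat_rcons mulrCA -!altZ; over.
  (* The multiple of [v i.+1 r] stands next to [v i.+1 r] itself and vanishes. Each remaining
     [v i k], with [last s < k < r], falls under the induction hypothesis for the row above. *)
  rewrite -alt_sum; have [c ->] := row_expand_lt i (last (lam 0%N) s) rlam.
  rewrite -sumrN altD altZ D_alternating mulr0 add0r alt_sum.
  under eq_bigr => k _.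
    rewrite -scaleN1r !altZ mulN1r mulrCA -mulrN; over.
  over.
rewrite chain_sum_sum big_nat_cond big1 // => k /andP[/andP[_ kr] _].
rewrite chain_sumZ; under eq_chain_sum do rewrite -mulN1r.
by rewrite chain_sumZ IH ?mulr0 //; have := lam_anti i; lia.
Qed.

(** The last row is summed first: [row_expand] gives the wanted row minus multiples of [v i k] with
    [k] larger than the previous part, which [chain_sum_lt] cancels. The first row has [p = lam 0]
    and needs no correction. *)
Lemma chain_sum_det i w :
  L i (fun s => D (chain_rows s ++ w)) =
  D (mkseq (fun k => phi k (lam k) + x *: v k (lam k)) i ++ w).
Proof.
elim: i w => [|i IH] w //; rewrite mkseqS cat_rcons -IH.
rewrite chain_sumS.
under eq_chain_sum => s szs.
  under eq_bigr => q _ do rewrite chain_rows_rcons szs cat_rcons -altZ.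
  rewrite -alt_sum; over.
case: i IH => [|i] IH.
  by rewrite /= minnn row_sum_full.
under eq_chain_sum => s szs.
  rewrite row_expand altD -sumrN alt_sum.
  under [X in _ + X]eq_bigr => k _.
    rewrite -scaleN1r !altZ mulN1r mulrCA -mulrN; over.
  over.
rewrite chain_sumD chain_sum_sum [X in _ + X]big_nat_cond [X in _ + X]big1 ?addr0 //.
move=> k /andP[/andP[_ kr] _].
rewrite chain_sumZ; under eq_chain_sum do rewrite -mulN1r.
by rewrite chain_sumZ chain_sum_lt ?mulr0 //; have := lam_anti i; lia.
Qed.

End AlternatingExpansion.

(** * Shifting the parts, and chains as tuples *)

Section ChainSumReindexing.
Variables (K : comNzRingType) (x : K) (a b : nat -> K) (lam : nat -> nat).

Lemma chain_sum_shift n i G :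
  (forall s, size s = i -> (last (lam 0 + n)%N s < n)%N -> G s = 0) ->
  chain_sum x (fun k => a (k - n)%N) b (fun k => lam k + n)%N i G =
  chain_sum x a b lam i (fun s => G [seq (q + n)%N | q <- s]).
Proof.
elim: i G => [|i IH] G G0 //; rewrite !chain_sumS IH.
  apply: eq_chain_sum => s szs.
  rewrite (last_map (fun q => q + n)%N) -addn_minl -addSn.
  rewrite (big_cat_nat (n := n)) //=; last lia.
  rewrite big_nat_cond big1 ?add0r => [|q /andP[/andP[_ qn] _]]; last first.
    by rewrite G0 ?mulr0 ?size_rcons ?size_map ?szs ?last_rcons.
  rewrite -[X in \sum_(X <= _ < _) _]add0n big_addn addnK.
  apply: eq_bigr => q _; rewrite map_rcons; congr (_ * _).
  rewrite /row_weight big_addn addnK; apply: eq_bigr => j _.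
  by rewrite -addSn !ltn_add2r addnK.
(* Once a part is below [n], so are all later ones; the vanishing hypothesis thus passes to the
   inner sum. *)
move=> s szs lts; rewrite big_nat_cond big1 // => q /andP[/andP[_ qs] _].
by rewrite G0 ?mulr0 ?size_rcons ?szs ?last_rcons //; lia.
Qed.

Definition is_chain (s : seq nat) : bool :=
  all (fun k => nth 0 s k <= minn (nth 0 (lam 0 :: s) k) (lam k))%N
      (iota 0 (size s)).

Definition chain_weight (s : seq nat) : K :=
  \prod_(k < size s)
    row_weight x a b k (nth 0%N (lam 0%N :: s) k) (lam k) (nth 0%N s k).

Lemma nth_cons_last (y : nat) s : nth 0%N (y :: s) (size s) = last y s.
Proof. by rewrite -last_nth. Qed.

Lemma nth_cons_rcons (y q : nat) s k : (k <= size s)%N ->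
  nth 0%N (y :: rcons s q) k = nth 0%N (y :: s) k.
Proof. by move=> ks; rewrite -rcons_cons nth_rcons /= ltnS ks. Qed.

Lemma is_chain_rcons s q :
  is_chain (rcons s q) =
  is_chain s && (q <= minn (last (lam 0%N) s) (lam (size s)))%N.
Proof.
rewrite /is_chain size_rcons -addn1 iotaD all_cat /= add0n andbT.
rewrite nth_cons_rcons // nth_cons_last nth_rcons ltnn eqxx.
congr (_ && _); apply: eq_in_all => k; rewrite mem_iota add0n => /andP[_ ks].
by rewrite nth_cons_rcons ?(ltnW ks) // nth_rcons ks.
Qed.

Lemma chain_weight_rcons s q :
  chain_weight (rcons s q) =
  chain_weight s
  * row_weight x a b (size s) (last (lam 0%N) s) (lam (size s)) q.
Proof.
rewrite /chain_weight size_rcons big_ord_recr /=.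
rewrite nth_cons_rcons // nth_cons_last nth_rcons ltnn eqxx.
congr (_ * _); apply: eq_bigr => -[k ks] _ /=.
by rewrite nth_cons_rcons ?(ltnW ks) // nth_rcons ks.
Qed.

Lemma big_tuple_rcons (T : finType) n (F : n.+1.-tuple T -> K) :
  \sum_t F t = \sum_(t : n.-tuple T) \sum_q F [tuple of rcons t q].
Proof.
pose h (p : n.-tuple T * T) : n.+1.-tuple T := [tuple of rcons p.1 p.2].
rewrite (reindex h) ?pair_bigA //; apply: onW_bij.
apply: inj_card_bij; last by rewrite card_prod !card_tuple expnSr.
by move=> [s y] [t z] /(congr1 val)/= /rcons_inj[/val_inj -> ->].
Qed.

(** The bound [M] makes the index type finite, so that the chains can index a partition of the set
    of fillings. *)
Lemma chain_sum_tuple M i G : (forall k, lam k < M)%N ->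
  chain_sum x a b lam i G =
  \sum_(t : i.-tuple 'I_M | is_chain (map val t))
     chain_weight (map val t) * G (map val t).
Proof.
move=> lamM; elim: i G => [|i IH] G.
  rewrite big_mkcond (big_pred1 [tuple]) /= => [|t]; last first.
    by apply/esym/eqP; rewrite [t]tuple0 [RHS]tuple0.
  by rewrite /chain_weight big_ord0 mul1r.
rewrite chain_sumS IH big_mkcond [RHS]big_mkcond [RHS]big_tuple_rcons.
apply: eq_bigr => t _; set s := map val t.
have szs : size s = i by rewrite size_map size_tuple.
have sE q : map val [tuple of rcons t q] = rcons s (val q) by rewrite map_rcons.
under [RHS]eq_bigr => q _.
  rewrite sE is_chain_rcons chain_weight_rcons szs; over.
case: (is_chain s) => /=; last by rewrite big1.
rewrite mulr_sumr -big_mkcond big_mkord.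
rewrite -(big_mkord xpredT (fun q => chain_weight s *
  (row_weight x a b i (last (lam 0%N) s) (lam i) q * G (rcons s q)))).
rewrite (big_nat_widen _ _ M); last by have := lamM i; lia.
by rewrite big_mkord; apply: eq_big => q; rewrite ?mulrA.
Qed.

End ChainSumReindexing.

(** * Power series and Jacobi-Trudi determinants *)

Section Series.
Variable K : comNzRingType.
Implicit Types (f g : nat -> K) (c d : K).

(* A function [f] stands for the power series [\sum_k f k * t ^ k]: [sh] is the
   multiplication by [t], [lin c] by [1 - c t] and [geo c] by its inverse. *)
Definition sh f (k : nat) : K := if k is k'.+1 then f k' else 0.
Definition lin c f (k : nat) : K := f k - c * sh f k.
Fixpoint geo c f (k : nat) : K := if k is k'.+1 then f k + c * geo c f k' else f 0%N.
Definition unit_series (k : nat) : K := (k == 0%N)%:R.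

(** The ranges differ: [lins a m] involves [a 0, ..., a (m - 1)] and [geos b i] involves
    [b 1, ..., b i]. With [a 0 = 0] and a 0-based row [i], these match the alphabets [A_(m-1)] and
    [B_i]. *)
Fixpoint lins (a : nat -> K) m f := if m is m'.+1 then lin (a m') (lins a m' f) else f.
Fixpoint geos (b : nat -> K) i f := if i is i'.+1 then geo (b i) (geos b i' f) else f.

Lemma geoE c f k : geo c f k = f k + c * sh (geo c f) k.
Proof. by case: k => [|k] //=; rewrite mulr0 addr0. Qed.

Lemma geoK c f : lin c (geo c f) = f.
Proof. by apply: functional_extensionality => k; rewrite /lin geoE addrK. Qed.

Lemma linK c f : geo c (lin c f) = f.
Proof.
apply: functional_extensionality; elim=> [|k IH] /=; rewrite /lin /=.
  by rewrite mulr0 subr0.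
by rewrite IH subrK.
Qed.

Lemma lin0 f : lin 0 f = f.
Proof. by apply: functional_extensionality => k; rewrite /lin mul0r subr0. Qed.

Lemma sh_lin c f : sh (lin c f) = lin c (sh f).
Proof. by apply: functional_extensionality => -[|k] //; rewrite /lin /= mulr0 subr0. Qed.

Lemma linC c d f : lin c (lin d f) = lin d (lin c f).
Proof.
apply: functional_extensionality => k; rewrite {1 3}/lin !sh_lin /lin; ring.
Qed.

Lemma geo_lin c d f : geo c (lin d f) = lin d (geo c f).
Proof. by rewrite -{1}(geoK c f) linC linK. Qed.

Lemma geoC c d f : geo c (geo d f) = geo d (geo c f).
Proof. by rewrite -{1}(geoK c f) geo_lin linK. Qed.

Lemma geo_lins a m c f : geo c (lins a m f) = lins a m (geo c f).
Proof. by elim: m => //= m IH; rewrite geo_lin IH. Qed.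

Lemma geo_geos b i c f : geo c (geos b i f) = geos b i (geo c f).
Proof. by elim: i => //= i IH; rewrite geoC IH. Qed.

Lemma lin_lins a m c f : lin c (lins a m f) = lins a m (lin c f).
Proof. by elim: m => //= m IH; rewrite linC IH. Qed.

Lemma iter_shE i f k : iter i sh f k = if (i <= k)%N then f (k - i)%N else 0.
Proof.
elim: i k => [|i IH] k; first by rewrite subn0.
by case: k => [|k] //=; rewrite IH ltnS subSS.
Qed.

Lemma iter_sh_add i n f k : iter (i + n) sh f (k + n) = iter i sh f k.
Proof. by rewrite !iter_shE leq_add2r subnDr. Qed.

Lemma iter_sh_addl i n f k : iter (i + n) sh f (n + k)%N = iter i sh f k.
Proof. by rewrite [(n + k)%N]addnC iter_sh_add. Qed.

Lemma iter_shSS i f k : iter i.+1 sh f k.+1 = iter i sh f k.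
Proof. by []. Qed.

Lemma iter_sh_lin i c f k : iter i sh (lin c f) k = iter i sh f k - c * iter i.+1 sh f k.
Proof.
rewrite !iter_shE /lin; have [ki|ik|->] := ltngtP k i.
- by rewrite mulr0 subr0.
- by rewrite -(subnSK ik).
- by rewrite subnn.
Qed.

(** Truncated subtraction sends the first [n] indices to [0], so their factors are
    [1 - a 0 t = 1]. *)
Lemma lins_shift a n m f : a 0%N = 0 ->
  lins (fun k => a (k - n)%N) (m + n) f = lins a m f.
Proof.
move=> a0; elim: m => [|m IH]; last by rewrite addSn /= IH addnK.
have lins_small k : (k <= n)%N -> lins (fun k => a (k - n)%N) k f = f.
  elim: k => //= k IHk kn; rewrite IHk 1?ltnW // (_ : k - n = 0)%N ?a0 ?lin0 //; lia.
exact: lins_small.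
Qed.

End Series.

(** * Jacobi-Trudi determinants and their branching rule *)

Section JacobiTrudi.
Variables (K : comNzRingType) (n : nat) (a b : nat -> K).

Definition row_series (xs : seq K) (i m : nat) : nat -> K :=
  lins a m (geos b i (foldr (@geo K) (@unit_series K) xs)).

(** Shifting the series by [i] gives its coefficient of index [lam i + k - i], read as zero when
    this index is negative. *)
Definition jacobi_trudi (xs : seq K) (lam : nat -> nat) : K :=
  \det (\matrix_(i < n, k < n)
          iter i (@sh K) (row_series xs i (lam i)) (lam i + k)%N).

(** The value [0] on lists of the wrong length makes linearity and alternation hold for all
    lists. *)
Definition seq_det (s : seq 'rV[K]_n) : K :=
  if size s == n then \det (\matrix_(i < n) nth 0 s i) else 0.

Lemma seq_det_linear s t c u v :
  seq_det (s ++ (c *: u + v) :: t) = c * seq_det (s ++ u :: t) + seq_det (s ++ v :: t).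
Proof.
rewrite /seq_det !size_cat /=; case: eqP => [szn|_]; last by rewrite mulr0 addr0.
have ltn : (size s < n)%N by have := leq_addr (size t) (size s).+1; rewrite addSnnS szn.
rewrite -[X in _ = _ + X]mul1r.
apply: (determinant_multilinear (i0 := Ordinal ltn)).
- by rewrite !rowK /= !nth_cat ltnn subnn /= scale1r.
- apply/row_matrixP => i; rewrite !row_rowsub !rowK !nth_cat.
  case: ltnP => // le; case E: (_ - _)%N => [|k] //.
  by have /eqP[] := neq_lift (Ordinal ltn) i; apply: val_inj => /=; move: E le => /=; lia.
- apply/row_matrixP => i; rewrite !row_rowsub !rowK !nth_cat.
  case: ltnP => // le; case E: (_ - _)%N => [|k] //.
  by have /eqP[] := neq_lift (Ordinal ltn) i; apply: val_inj => /=; move: E le => /=; lia.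
Qed.

Lemma seq_det_alternating s t u : seq_det (s ++ u :: u :: t) = 0.
Proof.
rewrite /seq_det !size_cat /=; case: eqP => [szn|//].
have lt2 : ((size s).+1 < n)%N.
  by have := leq_addr (size t) (size s).+2; rewrite !addSnnS szn.
have lt1 := ltnW lt2.
apply: (determinant_alternate (i1 := Ordinal lt1) (i2 := Ordinal lt2)).
  by apply/eqP => /(congr1 val) /=; lia.
by move=> j; rewrite !mxE !nth_cat ltnn subnn ltnNge leqnSn subSnn.
Qed.

Hypothesis a0 : a 0%N = 0.
Variables (lam : nat -> nat).
Hypothesis lam_anti : forall i, (lam i.+1 <= lam i)%N.

Lemma jacobi_trudi_branching x xs :
  jacobi_trudi (x :: xs) lam =
  chain_sum x a b lam n (fun mu => jacobi_trudi xs (nth 0%N mu)).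
Proof.
(* All the parts are shifted by [n], which makes [v i 0] vanish: this accounts
   for negative parts, which contribute nothing as the last row is then zero. *)
pose a' k := a (k - n)%N.
pose g i m := lins a' m (geos b i (foldr (@geo K) (@unit_series K) xs)).
pose phi i m : 'rV[K]_n := \row_j iter (i + n) (@sh K) (g i m) (m + j)%N.
(* The additional shift is the factor [t] in [1 / (s - x) = t / (1 - x t)]. *)
pose v i m : 'rV[K]_n := \row_j iter (i + n).+1 (@sh K) (geo x (g i m)) (m + j)%N.
have gS i m : g i m.+1 = lin (a' m) (g i m) by [].
have gb i m : g i m = lin (b i.+1) (g i.+1 m) by rewrite /g /= lin_lins geoK.
have phiE i m : phi i m = v i m.+1 - (x - a' m) *: v i m.
  apply/rowP => j; rewrite !mxE addSn iter_shSS gS geo_lin.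
  rewrite -{1}(geoK x (g i m)) !iter_sh_lin; ring.
have vE i m : v i m = v i.+1 m.+1 + (a' m - b i.+1) *: v i.+1 m.
  apply/rowP => j; rewrite !mxE !addSn iter_shSS gS gb !geo_lin !iter_sh_lin; ring.
have v0 i : v i 0%N = 0.
  by apply/rowP => j; rewrite !mxE iter_shE ifF //; have := ltn_ord j; lia.
pose lam' k := (lam k + n)%N.
have lam'_anti i : (lam' i.+1 <= lam' i)%N by rewrite leq_add2r.
have := chain_sum_det seq_det_linear seq_det_alternating phiE vE v0 lam'_anti n [::].
rewrite chain_sum_shift.
  rewrite cats0 => E; transitivity (chain_sum x a b lam n
    (fun s => seq_det (chain_rows phi [seq (q + n)%N | q <- s] ++ [::]))).
    rewrite E /seq_det size_mkseq eqxx /jacobi_trudi; congr (\det _).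
    apply/matrixP => i j; rewrite !mxE nth_mkseq // !mxE.
    rewrite /row_series /= -geo_geos -geo_lins.
    have <- : g i (lam' i) = lins a (lam i)
        (geos b i (foldr (@geo K) (@unit_series K) xs)) by exact: lins_shift.
    rewrite -(iter_sh_addl i n) addnA [(n + lam i)%N]addnC -/(lam' i).
    by rewrite -{2}(geoK x (g i (lam' i))) iter_sh_lin subrK.
  apply: eq_chain_sum => s szs.
  rewrite cats0 /seq_det size_mkseq size_map szs eqxx; congr (\det _).
  apply/matrixP => i j; rewrite !mxE nth_mkseq ?size_map ?szs // !mxE.
  rewrite (nth_map 0%N) ?szs // /g lins_shift //.
  by rewrite -addnA addnCA iter_sh_addl.
move=> s; case/lastP: s => [|s q]; first by move=> /= _; lia.
rewrite size_rcons last_rcons => szs qn.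
rewrite chain_rows_rcons cats0 -cats1.
rewrite (_ : phi _ _ = 0) ?(alt0 seq_det_linear) //.
(* Here [size s = n - 1], so the shift is [2n - 1], while [q + j <= 2n - 2]. *)
by apply/rowP => j; rewrite !mxE iter_shE ifF //; have := ltn_ord j; lia.
Qed.

End JacobiTrudi.

(** * The bialternant and the Jacobi-Trudi determinant *)

Section Bialternant.
Variables (K : comNzRingType) (n : nat) (a b : nat -> K).

Lemma row_seriesE xs i m :
  row_series a b xs i m =
  foldr (@geo K) (lins a m (geos b i (@unit_series K))) xs.
Proof.
rewrite /row_series; elim: xs => //= y xs <-.
by rewrite -geo_geos -geo_lins.
Qed.

Lemma geos0 i f : geos b i f 0%N = f 0%N.
Proof. by elim: i => //= i IH; rewrite geoE /= mulr0 addr0. Qed.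

Lemma lins_unit_eq0 m k : a 0%N = 0 -> (m < k)%N -> lins a m.+1 (@unit_series K) k = 0.
Proof.
move=> a0; elim: m k => [|m IH] k mk.
  by rewrite /= a0 lin0 /unit_series; case: k mk.
pose f := lins a m.+1 (@unit_series K).
rewrite -[LHS]/(f k - a m.+1 * sh f k) {1}/f IH; last lia.
by case: k mk => // k mk; rewrite -[sh f _]/(f k) /f IH ?mulr0 ?subr0.
Qed.

(** If all parts vanish, the matrix is triangular with unit diagonal. Otherwise the first row
    consists of coefficients of index at least [lam 0] of a polynomial of degree less than [lam 0],
    because [a 0 = 0]. *)
Lemma jacobi_trudi_nil lam : a 0%N = 0 -> (forall i, lam i.+1 <= lam i)%N ->
  jacobi_trudi n a b [::] lam = [forall i : 'I_n, lam i == 0%N]%:R.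
Proof.
move=> a0 lam_anti; rewrite /jacobi_trudi /row_series /=.
case: forallP => [lam0|nlam0] /=.
  rewrite -det_tr det_trig.
    rewrite big1 // => i _; rewrite !mxE (eqP (lam0 i)) iter_shE leqnn subnn.
    by rewrite /= geos0.
  apply/is_trig_mxP => i j ij; rewrite !mxE (eqP (lam0 j)) iter_shE.
  by rewrite add0n leqNgt ij.
have lam_le i : (lam i <= lam 0%N)%N by elim: i => // i IH; exact: leq_trans IH.
case: n nlam0 => [|n'] nlam0; first by case: nlam0 => -[].
have lam0 : (0 < lam 0%N)%N.
  rewrite lt0n; apply/eqP => lam0; case: nlam0 => i.
  by have := lam_le i; rewrite lam0 leqn0.
rewrite (expand_det_row _ ord0) big1 // => j _; rewrite !mxE.
case E: (lam 0%N) lam0 => [//|l] _.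
by rewrite iter_shE subn0 [geos _ _ _]/= lins_unit_eq0 ?mul0r //; lia.
Qed.

Section Reduction.
Variables (I : eqType) (y : I -> K).
Local Notation geo_all := (foldr (fun l => geo (y l))).
Local Notation lin_all := (foldr (fun l => lin (y l))).

Lemma geo_all_rem f s j : j \in s -> geo_all f s = geo (y j) (geo_all f (rem j s)).
Proof.
elim: s => //= l s IH; rewrite inE eq_sym; case: eqP => [->|_] //= js.
by rewrite IH // geoC.
Qed.

Lemma geo_lin_all f c s : geo c (lin_all f s) = lin_all (geo c f) s.
Proof. by elim: s => //= l s IH; rewrite geo_lin IH. Qed.

Lemma lin_geo_all f s : lin_all (geo_all f s) s = f.
Proof.
elim: s => //= l s IH.
by rewrite -geo_lin_all IH geoK.
Qed.

(** With [d = size s], the product of the [1 - y_l t] is [t^d] times the product of the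
    [t^-1 - y_l], so the coefficient of index [k] goes with [t^(d - k)]. *)
Lemma lin_all_coef f s r :
  lin_all f s r = \sum_(k < (size s).+1)
    (\prod_(l <- s) ('X - (y l)%:P))`_k * iter (size s - k) (@sh K) f r.
Proof.
elim: s r => [|l s IH] r.
  by rewrite big_ord1 big_nil coef1 mul1r.
set p := \prod_(_ <- s) _ in IH *.
have sz_p : size p = (size s).+1 by rewrite size_prod_XsubC.
have shE : sh (lin_all f s) r =
    \sum_(k < (size s).+1) p`_k * iter (size s - k).+1 (@sh K) f r.
  by case: r => [|r] /=; [rewrite big1 // => k _; rewrite mulr0 | rewrite IH].
rewrite [LHS]/(lin_all f s r - y l * sh (lin_all f s) r) shE IH big_cons -/p.
under [RHS]eq_bigr => k _ do rewrite mulrBl coefB coefXM coefCM mulrBl.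
rewrite [RHS]sumrB; congr (_ - _).
  by rewrite [RHS]big_ord_recl /= mul0r add0r.
rewrite [RHS]big_ord_recr /= [p`_(size s).+1]nth_default ?sz_p //.
rewrite mulr0 mul0r addr0 mulr_sumr; apply: eq_bigr => -[k ks] _ /=.
by rewrite mulrA subSn.
Qed.

End Reduction.

Variable y : 'I_n -> K.

(** Column [j] holds the coefficients of the Lagrange polynomial at the node [y j], before
    normalization. *)
Definition vandermonde_minors : 'M[K]_n :=
  \matrix_(k, j) (\prod_(l <- rem j (enum 'I_n)) ('X - (y l)%:P))`_k.

Lemma size_rem_enum (j : 'I_n) : size (rem j (enum 'I_n)) = n.-1.
Proof. by rewrite size_rem ?mem_enum // size_enum_ord. Qed.

Lemma big_rem_enum (j : 'I_n) (F : 'I_n -> K) :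
  \prod_(l <- rem j (enum 'I_n)) F l = \prod_(l | l != j) F l.
Proof.
rewrite rem_filter ?enum_uniq // big_filter big_enum_cond.
by apply: eq_bigl => l; rewrite inE.
Qed.

(** The series with the single variable [y j] is the series with all variables times the product of
    [1 - y_l t] over [l != j]; expanding this product by [lin_all_coef] gives a matrix product. *)
Lemma bialternant_mul (lam : nat -> nat) :
  \det (\matrix_(i < n, j < n)
     geo (y j) (lins a (lam i) (geos b i (@unit_series K))) (lam i + (n.-1 - i))%N) =
  jacobi_trudi n a b (map y (enum 'I_n)) lam * \det vandermonde_minors.
Proof.
rewrite -det_mulmx; congr (\det _); apply/matrixP => i j; rewrite !mxE.
set f := lins _ _ _.
have := geo_all_rem y f (mem_enum 'I_n j).
set rest := rem j _; move=> E.
have -> : geo (y j) f =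
    foldr (fun l => lin (y l)) (row_series a b (map y (enum 'I_n)) i (lam i)) rest.
  by rewrite row_seriesE foldr_map E -geo_lin_all lin_geo_all.
have n0 : n.-1.+1 = n by rewrite prednK //; apply: leq_ltn_trans (ltn_ord i).
rewrite lin_all_coef size_rem_enum n0; apply: eq_bigr => k _.
rewrite !mxE mulrC; congr (_ * _); rewrite !iter_shE.
have := ltn_ord i; have := ltn_ord k => kn i_n.
rewrite (_ : (n.-1 - k <= lam i + (n.-1 - i)) = (i <= lam i + k))%N; last lia.
by case: leqP => // _; congr (row_series _ _ _ _ _ _); lia.
Qed.

Hypothesis vandermonde_reg :
  GRing.lreg (\prod_(i < n) \prod_(j < n | (i < j)%N) (y j - y i)).

(** Evaluating column [j] at the nodes gives a diagonal matrix, whose determinant is the product of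
    all [y j - y l] with [l != j]. Half of these factors form the Vandermonde determinant, which is
    cancelled. *)
Lemma det_vandermonde_minors :
  \det vandermonde_minors = \prod_(i < n) \prod_(j < n | (i < j)%N) (y i - y j).
Proof.
apply: vandermonde_reg.
have := det_Vandermonde (\row_j y j); rewrite -det_tr.
under eq_bigr => i _ do under eq_bigr => j _ do rewrite !mxE.
move=> detV; rewrite -{1}detV -det_mulmx.
have -> : (Vandermonde n (\row_j y j))^T *m vandermonde_minors =
    diag_mx (\row_j \prod_(l | l != j) (y j - y l)).
  apply/matrixP => m j; rewrite !mxE.
  set p := \prod_(l <- rem j (enum 'I_n)) ('X - (y l)%:P).
  transitivity p.[y m].
    have n0 : n.-1.+1 = n by rewrite prednK //; apply: leq_ltn_trans (ltn_ord m).
    have sz_p : size p = n by rewrite size_prod_XsubC size_rem_enum.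
    rewrite horner_coef sz_p; apply: eq_bigr => k _.
    by rewrite !mxE mulrC.
  rewrite horner_prod; under eq_bigr => l _ do rewrite hornerXsubC.
  rewrite big_rem_enum; case: (eqVneq m j) => [->|mj] //.
  by rewrite mulr0n (bigD1 m) //= subrr mul0r.
rewrite det_diag; under eq_bigr => j _ do rewrite mxE.
rewrite mulrC [X in _ = _ * X](exchange_big_dep xpredT) //= -big_split /=.
apply: eq_bigr => j _; rewrite (bigID (fun l : 'I_n => (j < l)%N)) /=.
by congr (_ * _); apply: eq_bigl => l; rewrite -val_eqE /=; lia.
Qed.

Lemma bialternantE (lam : nat -> nat) :
  \det (\matrix_(i < n, j < n)
     geo (y j) (lins a (lam i) (geos b i (@unit_series K))) (lam i + (n.-1 - i))%N) =
  jacobi_trudi n a b (map y (enum 'I_n)) lam *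
  \prod_(i < n) \prod_(j < n | (i < j)%N) (y i - y j).
Proof. by rewrite bialternant_mul det_vandermonde_minors. Qed.

End Bialternant.

(** * The polynomials h_m *)

Section TruncatedSeries.
Variable K : comNzRingType.
Implicit Types (p : {poly K}) (f : nat -> K) (v : K).

Definition trunc_geom (d : nat) v : {poly K} := \poly_(k < d.+1) v ^+ k.

Lemma trunc_geomE d v : (1 - v *: 'X) * trunc_geom d v = 1 - (v *: 'X) ^+ d.+1.
Proof.
rewrite -[RHS]opprB subrX1 -mulNr opprB; congr (_ * _).
by rewrite /trunc_geom poly_def; apply: eq_bigr => k _; rewrite exprZn.
Qed.

Definition agree d p f := forall k, (k <= d)%N -> p`_k = f k.

Lemma agree_lin d p f v : agree d p f -> agree d (p * (1 - v *: 'X)) (lin v f).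
Proof.
move=> pf k kd; rewrite mulrBr mulr1 coefB -scalerAr coefZ coefMX /lin pf //.
by case: k kd => //= k kd; rewrite pf // ltnW.
Qed.

(** By [trunc_geomE], multiplying the product by [1 - v t] gives back [p] modulo [t^(d+1)]; up to
    index [d] its coefficients thus obey the recurrence defining [geo]. *)
Lemma agree_geo d p f v : agree d p f -> agree d (p * trunc_geom d v) (geo v f).
Proof.
move=> pf; set q := p * _.
have qE k : (k <= d)%N -> q`_k = p`_k + v * sh (fun i => q`_i) k.
  move=> kd; apply/eqP; rewrite -subr_eq; apply/eqP.
  transitivity ((q * (1 - v *: 'X))`_k).
    rewrite mulrBr mulr1 coefB -scalerAr coefZ coefMX.
    by case: (k).
  rewrite /q -mulrA [trunc_geom _ _ * _]mulrC trunc_geomE mulrBr mulr1 coefB.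
  by rewrite exprZn -scalerAr coefZ coefMXn ltnS kd mulr0 subr0.
elim=> [|k IH] kd; rewrite qE //= pf // ?mulr0 ?addr0 //.
by rewrite IH // ltnW.
Qed.

Lemma agree_alphabet (a b : nat -> K) v d m i : a 0%N = 0 ->
  (trunc_geom d v * (\prod_(k <- iota 0 m.-1) (1 - a k.+1 *: 'X) *
                     \prod_(k <- iota 0 i) trunc_geom d (b k.+1)))`_d =
  geo v (lins a m (geos b i (@unit_series K))) d.
Proof.
move=> a0; rewrite mulrC; set P := _ * \prod_(k <- _) _.
suff PE : agree d P (lins a m (geos b i (@unit_series K))).
  by apply: agree_geo PE _ _.
rewrite {}/P mulrC.
have base : agree d (\prod_(k <- iota 0 i) trunc_geom d (b k.+1))
    (geos b i (@unit_series K)).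
  elim: i => [|i IH].
    by move=> k _; rewrite big_nil coef1.
  by rewrite -addn1 iotaD big_cat big_seq1 addn1 /= add0n; exact: agree_geo.
case: m => [|m] /=; first by rewrite big_nil mulr1.
elim: m => [|m IH]; first by rewrite big_nil mulr1 /= a0 lin0.
rewrite -addn1 iotaD big_cat big_seq1 addn1 /= add0n mulrA.
exact: agree_lin.
Qed.

End TruncatedSeries.

(* Since [1 - 0 t = 1], setting the junk value [al_seq 0] to [0] makes the
   product over [k < m] equal to the one over [1 <= k < m], also for [m = 0]. *)
Definition al_seq (k : nat) : polring := if k == 0%N then 0 else var (al k).
Definition be_seq (k : nat) : polring := var (be k).

Lemma A_coef m (v : indet) :
  (A m)@_v = if v is inr (inl q) then ((q < m)%N%:R : int) else 0.
Proof.
rewrite /A; elim: m => [|m IH].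
  by rewrite big_geq // mcoeff0; case: v => [|[]].
rewrite big_nat_recr //= mcoeffD IH mcoeffU.
case: v {IH} => [q|[q|q]] //=; rewrite ?addr0 //.
rewrite [in RHS]ltnS -[_ == _]/(m == q).
by case: (ltngtP q m).
Qed.

Lemma B_coef m (v : indet) :
  (B m)@_v = if v is inr (inr q) then ((q < m)%N%:R : int) else 0.
Proof.
rewrite /B; elim: m => [|m IH].
  by rewrite big_geq // mcoeff0; case: v => [|[]].
rewrite big_nat_recr //= mcoeffD IH mcoeffU.
case: v {IH} => [q|[q|q]] //=; rewrite ?addr0 //.
rewrite [in RHS]ltnS -[_ == _]/(m == q).
by case: (ltngtP q m).
Qed.

(** The letters are pairwise distinct, so nothing cancels. *)
Lemma msupp_alphabet q m i :
  perm_eq (msupp (<< xi q.+1 >> - A m + B i))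
    (xi q.+1 :: [seq al k.+1 | k <- iota 0 m] ++ [seq be k.+1 | k <- iota 0 i]).
Proof.
apply: uniq_perm; first exact: fset_uniq.
  rewrite /= cat_uniq !map_inj_uniq ?iota_uniq //; try by move=> ? ? [].
  rewrite mem_cat negb_or /= andbT; apply/andP; split.
    by apply/andP; split; apply/negP => /mapP[].
  by apply/hasPn => _ /mapP[k _ ->]; apply/negP => /mapP[].
have al_inj : injective (fun k => al k.+1) by move=> ? ? [].
have be_inj : injective (fun k => be k.+1) by move=> ? ? [].
move=> v; rewrite -mcoeff_neq0 mcoeffD mcoeffB A_coef B_coef mcoeffU.
rewrite inE mem_cat; case: v => [k|[k|k]].
- have notal : (inl k : indet) \in [seq al k.+1 | k <- iota 0 m] = false.
    by apply/negP => /mapP[].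
  have notbe : (inl k : indet) \in [seq be k.+1 | k <- iota 0 i] = false.
    by apply/negP => /mapP[].
  by rewrite subr0 addr0 notal notbe !orbF [inl k == _]eq_sym; case: (_ == inl k).
- have notbe : (inr (inl k) : indet) \in [seq be k.+1 | k <- iota 0 i] = false.
    by apply/negP => /mapP[].
  have -> : (inr (inl k) : indet) \in [seq al k.+1 | k <- iota 0 m] = (k < m)%N.
    by rewrite (mem_map al_inj _ k) mem_iota add0n.
  by rewrite notbe addr0 sub0r orbF /=; case: (k < m)%N.
- have notal : (inr (inr k) : indet) \in [seq al k.+1 | k <- iota 0 m] = false.
    by apply/negP => /mapP[].
  have -> : (inr (inr k) : indet) \in [seq be k.+1 | k <- iota 0 i] = (k < i)%N.
    by rewrite (mem_map be_inj _ k) mem_iota add0n.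
  by rewrite notal subr0 add0r orFb /=; case: (k < i)%N.
Qed.

Lemma h_alphabet d q m i :
  h d (<< xi q.+1 >> - A m.-1 + B i) =
  geo (var (xi q.+1))
    (lins al_seq m (geos be_seq i (@unit_series polring))) d.
Proof.
rewrite /h (perm_big _ (msupp_alphabet q m.-1 i)) big_cons big_cat !big_map /=.
set Z := (_ - _ + _).
have Zxi : Z@_(xi q.+1) = 1%:Z.
  by rewrite mcoeffD mcoeffB A_coef B_coef mcoeffU eqxx.
have Zal k : k \in iota 0 m.-1 -> Z@_(al k.+1) = -1%:Z.
  rewrite mem_iota add0n => /andP[_ km].
  by rewrite mcoeffD mcoeffB A_coef B_coef mcoeffU /= km.
have Zbe k : k \in iota 0 i -> Z@_(be k.+1) = 1%:Z.
  rewrite mem_iota add0n => /andP[_ ki].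
  by rewrite mcoeffD mcoeffB A_coef B_coef mcoeffU /= ki.
rewrite Zxi -agree_alphabet //; congr (nth _ (polyseq _) _); congr (_ * (_ * _)).
  by apply: eq_big_seq => k /Zal ->.
by apply: eq_big_seq => k /Zbe ->.
Qed.

(** * Coefficients in the polynomial ring *)

Section Support.
Variable C : comNzRingType.
Local Notation M := {malg C[{cmonom nat}]}.
Implicit Types (p q : M) (m : {cmonom nat}).

Lemma mcoeff_mul_eq0 p q m :
  (forall k l, mmul k l = m -> p@_k * q@_l = 0) -> (p * q)@_m = 0.
Proof.
move=> pq0; rewrite mcoeffMl big1 // => k _; rewrite big1 // => l _.
by case: eqP => [/pq0 ->|_]; rewrite ?mul0rn.
Qed.

(** Exponents are indexed from 0: [m i] is the exponent of the variable of index [i + 1]. *)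
Definition var_divides (i : nat) p := forall m, m i = 0%N -> p@_m = 0.

Definition vars_below (n : nat) p :=
  forall m i, (n <= i)%N -> m i != 0%N -> p@_m = 0.

Lemma var_divides_mul i p q : var_divides i p -> var_divides i (p * q).
Proof.
move=> pi m mi; apply: mcoeff_mul_eq0 => k l klm.
rewrite pi ?mul0r //; move: mi; rewrite -klm cmM; lia.
Qed.

Lemma vars_below_mul n p q : vars_below n p -> vars_below n q -> vars_below n (p * q).
Proof.
move=> pn qn m i ni mi; apply: mcoeff_mul_eq0 => k l klm.
move: mi; rewrite -klm cmM addn_eq0 negb_and => /orP[ki|li].
  by rewrite (pn k i) ?mul0r.
by rewrite (qn l i) ?mulr0.
Qed.

Lemma vars_below_C n (c : C) : vars_below n (malgC c : M).
Proof.
move=> m i _ mi; rewrite mcoeffC; case: eqP => // m1.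
by move: mi; rewrite m1 cm1.
Qed.

Lemma vars_below_N n p : vars_below n p -> vars_below n (- p).
Proof. by move=> pn m i ni mi; rewrite mcoeffN (pn m i) ?oppr0. Qed.

Lemma vars_below_prod n (I : finType) (F : I -> M) :
  (forall i, vars_below n (F i)) -> vars_below n (\prod_i F i).
Proof.
move=> Fn; elim/big_ind: _ => //; last exact: vars_below_mul.
by rewrite -mpolyC1E; exact: vars_below_C.
Qed.

Lemma vars_below_xi n k : (0 < k <= n)%N -> vars_below n (<< ucm k.-1 >> : M).
Proof.
move=> kn m i ni mi; rewrite /= mcoeffU1; case: eqP => // mE.
by move: mi; rewrite -mE cmU; case: eqP => //; lia.
Qed.

Lemma var_divides_xi k : var_divides k.-1 (<< ucm k.-1 >> : M).
Proof.
move=> m mk; rewrite /= mcoeffU1; case: eqP => // mE.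
by move: mk; rewrite -mE cmUU.
Qed.

Lemma mcoeff_var_mul (i : nat) p m :
  ((<< ucm i >> : M) * p)@_(mmul (ucm i) m) = p@_m.
Proof.
have cancel k : (mmul (ucm i) k == mmul (ucm i) m) = (k == m).
  apply/eqP/eqP => [E|->//]; apply/eqP/cmP => l.
  by have := congr1 (fun z : {cmonom nat} => z l) E; rewrite !cmM => /addnI.
rewrite mcoeffMl msuppU1 big_seq_fset1.
under eq_bigr => k _ do rewrite mcoeffU1 eqxx mul1r cancel.
rewrite [in RHS](monalgE p) raddf_sum /=; apply: eq_bigr => k _.
by rewrite mcoeffU.
Qed.

Lemma lreg_var_sub i j : i != j -> GRing.lreg (<< ucm i >> - << ucm j >> : M).
Proof.
move=> ij; apply: mulrI0_lreg => p /eqP; rewrite mulrBl subr_eq0 => /eqP p0.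
have divides_xi q l m' : m' l = 0%N -> ((<< ucm l >> : M) * q)@_m' = 0.
  exact: (var_divides_mul q (@var_divides_xi l.+1)).
apply/malgP => m; rewrite mcoeff0.
(* Comparing coefficients of [x_i m] moves one factor [x_j] of [m] to [x_i]. *)
have [d] := ubnP (m j); elim: d m => [m|d IH m]; first by rewrite ltn0.
rewrite ltnS => md.
have -> : p@_m = ((<< ucm j >> : M) * p)@_(mmul (ucm i) m).
  by rewrite -p0 mcoeff_var_mul.
have [m0|m_gt0] := posnP (m j).
  by apply: divides_xi; rewrite cmM m0 ucmE (negbTE ij).
pose m' := divcm m (ucm j).
have mE : m = mmul (ucm j) m'.
  apply/eqP/cmP => l; rewrite cmM divcmE ucmE.
  by case: eqP => [<-|_]; lia.
have -> : mmul (ucm i) m = mmul (ucm j) (mmul (ucm i) m').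
  by rewrite mE Monoid.mulmCA.
rewrite (mcoeff_var_mul j p); apply: IH.
by rewrite cmM ucmE (negbTE ij) divcmE ucmE eqxx; lia.
Qed.

End Support.

(** Both orientations of the product are used: this one is the denominator [g_den], the opposite one
    is the factor cancelled in [det_vandermonde_minors]. *)
Lemma lreg_prod_sub (K : comNzRingType) n (y : 'I_n -> K) :
  (forall i j : 'I_n, i != j -> GRing.lreg (y i - y j)) ->
  GRing.lreg (\prod_(i < n) \prod_(j < n | (i < j)%N) (y i - y j)).
Proof.
move=> yreg; elim/big_ind: _ => [||i _]; [exact: lreg1 | exact: lregM |].
elim/big_ind: _ => [||j ij]; [exact: lreg1 | exact: lregM |].
by apply: yreg; rewrite -val_eqE neq_ltn ij.
Qed.

Lemma lreg_prod_subC (K : comNzRingType) n (y : 'I_n -> K) :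
  (forall i j : 'I_n, i != j -> GRing.lreg (y i - y j)) ->
  GRing.lreg (\prod_(i < n) \prod_(j < n | (i < j)%N) (y j - y i)).
Proof.
move=> yreg; elim/big_ind: _ => [||i _]; [exact: lreg1 | exact: lregM |].
elim/big_ind: _ => [||j ij]; [exact: lreg1 | exact: lregM |].
by apply: yreg; rewrite -val_eqE neq_ltn ij orbT.
Qed.

Lemma lreg_xi n (i j : 'I_n) : i != j ->
  GRing.lreg (var (xi i.+1) - var (xi j.+1)).
Proof. by move=> ij; exact: (@lreg_var_sub coefring i j). Qed.

Lemma g_den_lreg n : GRing.lreg (g_den n).
Proof. exact: (lreg_prod_sub (@lreg_xi n)). Qed.

Lemma g_numE lam n :
  g_num lam n =
  jacobi_trudi n al_seq be_seq [seq var (xi (val j).+1) | j <- enum 'I_n] (nth 0%N lam)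
  * g_den n.
Proof.
rewrite /g_den -(bialternantE al_seq be_seq (lreg_prod_subC (@lreg_xi n))).
rewrite /g_num; congr (\det _); apply/matrixP => i j; rewrite !mxE.
rewrite /g_entry h_alphabet /part /=; congr (geo _ _ _).
by have := ltn_ord i; lia.
Qed.

(** * Reverse plane partitions with bounded entries *)

Lemma foldr_geo_perm (K : comNzRingType) (f : nat -> K) s s' :
  perm_eq s s' -> foldr (@geo K) f s = foldr (@geo K) f s'.
Proof.
elim: s s' => [|y s IH] s' ss'; first by rewrite (size0nil (esym (perm_size ss'))).
have ys' : y \in s' by rewrite -(perm_mem ss') mem_head.
rewrite (geo_all_rem id f ys') /=; congr (geo _ _); apply: IH.
by rewrite -(perm_cons y) (perm_trans ss') // perm_to_rem.
Qed.

Lemma jacobi_trudi_perm (K : comNzRingType) n (a b : nat -> K) xs ys lam :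
  perm_eq xs ys -> jacobi_trudi n a b xs lam = jacobi_trudi n a b ys lam.
Proof.
by move=> xy; rewrite /jacobi_trudi /row_series (foldr_geo_perm _ xy).
Qed.

Section Fillings.
Variable lam : seq nat.
Hypothesis lam_part : is_part lam.
Local Notation C := (cell lam).
Implicit Types (c d : C) (mu : nat -> nat).

Definition row0 c : nat := (val c).1.
Definition col0 c : nat := (val c).2.

Lemma nth_part_anti i : (nth 0 lam i.+1 <= nth 0 lam i)%N.
Proof.
have [il|li] := ltnP i.+1 (size lam); last by rewrite nth_default.
case/andP: lam_part => lam_sorted _.
by apply: (sortedP 0%N lam_sorted).
Qed.

Lemma nth_part_anti_le i j : (i <= j)%N -> (nth 0 lam j <= nth 0 lam i)%N.
Proof.
by move=> /subnK <-; elim: (j - i)%N => // k IH; exact: leq_trans (nth_part_anti _) IH.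
Qed.

Lemma cell_exists i j : (j < nth 0 lam i)%N ->
  exists c, row0 c = i /\ col0 c = j.
Proof.
move=> ji; have il : (i < size lam)%N.
  by rewrite ltnNge; apply: contraL ji => li; rewrite nth_default.
have jh : (j < head 0 lam)%N by rewrite -nth0 (leq_trans ji) // nth_part_anti_le.
by exists (exist _ (Ordinal il, Ordinal jh) ji).
Qed.

Lemma cell_inj c d : row0 c = row0 d -> col0 c = col0 d -> c = d.
Proof.
case: c d => [[i j] ci] [[i' j'] di]; rewrite /row0 /col0 /= => ii jj.
by apply: val_inj => /=; congr (_, _); apply: val_inj.
Qed.

Lemma col0_lt c : (col0 c < nth 0 lam (row0 c))%N.
Proof. exact: valP c. Qed.

Lemma is_rppP (T : {ffun C -> nat}) :
  reflect [/\ forall c, (0 < T c)%N,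
    forall c d, row0 c = row0 d -> (col0 c <= col0 d)%N -> (T c <= T d)%N
    & forall c d, col0 c = col0 d -> (row0 c <= row0 d)%N -> (T c <= T d)%N]
    (is_rpp T).
Proof.
apply: (iffP and3P) => [[/forallP T0 /forallP Tr /forallP Tc]|[T0 Tr Tc]]; split=> //.
- move=> c d rcd ccd; have /forallP/(_ d)/implyP := Tr c; apply.
  by rewrite /cell_row /cell_col -/(row0 c) -/(row0 d) rcd eqxx ltnS.
- move=> c d rcd ccd; have /forallP/(_ d)/implyP := Tc c; apply.
  by rewrite /cell_row /cell_col -/(col0 c) -/(col0 d) rcd eqxx ltnS.
- exact/forallP.
- by apply/forallP=> c; apply/forallP=> d; apply/implyP=> /andP[/eqP[cd]]; exact: Tr.
- by apply/forallP=> c; apply/forallP=> d; apply/implyP=> /andP[/eqP[cd]]; exact: Tc.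
Qed.

Lemma eq_rightP (T : {ffun C -> nat}) c :
  reflect (exists d, [/\ row0 d = row0 c, col0 d = (col0 c).+1 & T d = T c])
    (eq_right T c).
Proof.
apply: (iffP existsP) => -[d].
  by case/and3P => /eqP[rd] /eqP[cd] /eqP Td; exists d.
move=> [rd cd Td]; exists d; apply/and3P.
by rewrite /cell_row /cell_col -/(row0 d) -/(col0 d) rd cd Td.
Qed.

Lemma eq_aboveP (T : {ffun C -> nat}) c :
  reflect (exists d, [/\ (row0 d).+1 = row0 c, col0 d = col0 c & T d = T c])
    (eq_above T c).
Proof.
apply: (iffP existsP) => -[d].
  by case/and3P => /eqP[rd] /eqP[cd] /eqP Td; exists d.
move=> [rd cd Td]; exists d; apply/and3P.
by rewrite /cell_row /cell_col -/(row0 d) -/(col0 d) rd cd Td.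
Qed.

Variables (K : comNzRingType) (x a b : nat -> K).

Lemma prod_cells n (mu0 mu1 : nat -> nat) (f : nat -> nat -> K) :
  (forall i, mu1 i <= nth 0 lam i)%N -> (size lam <= n)%N ->
  \prod_(c : C | (mu0 (row0 c) <= col0 c < mu1 (row0 c))%N) f (row0 c) (col0 c) =
  \prod_(i < n) \prod_(mu0 i <= j < mu1 i) f i j.
Proof.
move=> mu1_le le_n.
rewrite -(big_mkord xpredT (fun i => \prod_(mu0 i <= j < mu1 i) f i j)).
rewrite (big_cat_nat (n := size lam)) //= [X in _ = _ * X]big_nat_cond.
rewrite [X in _ = _ * X]big1 ?mulr1; last first.
  move=> i /andP[/andP[li _] _]; rewrite big_geq //.
  by have := mu1_le i; rewrite nth_default // leqn0 => /eqP ->.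
rewrite big_mkord.
rewrite -(@big_sub_cond _ _ _ _
  [pred p : 'I_(size lam) * 'I_(head 0%N lam) | (p.2 < nth 0 lam p.1)%N]
  [pred p | (mu0 (val p.1) <= val p.2 < mu1 (val p.1))%N]
  (fun p => f (val p.1) (val p.2))) /=.
rewrite -(pair_big_dep xpredT
  (fun (i : 'I_(size lam)) (j : 'I_(head 0%N lam)) =>
     (j < nth 0 lam i)%N && (mu0 i <= j < mu1 i)%N)
  (fun i j => f (val i) (val j))) /=.
apply: eq_bigr => i _.
have le_h : (mu1 i <= head 0 lam)%N.
  by rewrite -nth0 (leq_trans (mu1_le i)) // nth_part_anti_le.
rewrite (big_nat_widen _ _ _ _ _ le_h) [RHS](big_nat_widenl _ 0%N) //= big_mkord.
apply: eq_bigl => j; have := mu1_le i; lia.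
Qed.

(** The sum of the weights of the cell unmarked and, where allowed, marked. Both depend on the
    filling alone, so the choices of marks are independent. *)
Definition cell_weight (T : {ffun C -> nat}) c : K :=
  (if eq_above T c then b (row0 c) else x (T c))
  - (if eq_right T c then a (col0 c).+1 else 0).

Variable N : nat.
Implicit Types (T : {ffun C -> 'I_N.+1}).

Definition nat_filling T : {ffun C -> nat} := [ffun c => val (T c)].

Lemma nat_fillingE T c : nat_filling T c = T c :> nat.
Proof. by rewrite ffunE. Qed.

(* The reverse plane partitions of shape [mu] with entries at most [m], the
   cells of [lam] outside [mu] being filled with [m + 1]. *)
Definition fits (m : nat) mu T : bool :=
  [&& is_rpp (nat_filling T),
      [forall c, (T c <= m)%N == (col0 c < mu (row0 c))%N]
    & [forall c, T c <= m.+1]%N].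

(** The filler [m + 1] lets all shapes [mu] share the cells of [lam]. It differs from every entry at
    most [m], so it does not affect the weights in the product. *)
Definition filling_sum (m : nat) mu : K :=
  \sum_(T | fits m mu T) \prod_(c | (T c <= m)%N) cell_weight (nat_filling T) c.

Lemma fitsP m mu T :
  reflect [/\ forall c, (0 < T c)%N,
    forall c d, row0 c = row0 d -> (col0 c <= col0 d)%N -> (T c <= T d)%N,
    forall c d, col0 c = col0 d -> (row0 c <= row0 d)%N -> (T c <= T d)%N,
    forall c, (T c <= m)%N = (col0 c < mu (row0 c))%N
    & forall c, (T c <= m.+1)%N]
    (fits m mu T).
Proof.
apply: (iffP and3P) => [[/is_rppP[T0 Tr Tc] /forallP Tm /forallP Tm1]|[T0 Tr Tc Tm Tm1]].
  split=> // [c|c d rcd ccd|c d rcd ccd|c]; last exact: (eqP (Tm c)).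
  - by have := T0 c; rewrite ffunE.
  - by have := Tr c d rcd ccd; rewrite !ffunE.
  - by have := Tc c d rcd ccd; rewrite !ffunE.
split; [apply/is_rppP; split=> [c|c d rcd ccd|c d rcd ccd]; rewrite !ffunE | |].
- exact: T0.
- exact: Tr.
- exact: Tc.
- by apply/forallP => c; rewrite Tm.
- exact/forallP.
Qed.

(** The only candidate is the constant filling [1], which fits exactly when [mu] is empty. *)
Lemma filling_sum0 n mu : (size lam <= n)%N -> (0 < N)%N ->
  (forall i, mu i <= nth 0 lam i)%N ->
  filling_sum 0 mu = [forall i : 'I_n, mu i == 0%N]%:R.
Proof.
move=> le_n N0 mu_le; case: forallP => [mu0|nmu0]; rewrite /filling_sum.
  have mu00 i : mu i = 0%N.
    have [i_n|ni] := ltnP i n; first exact/eqP/(mu0 (Ordinal i_n)).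
    by have := mu_le i; rewrite nth_default ?leqn0 ?(leq_trans le_n) // => /eqP.
  have oneE : (inord 1 : 'I_N.+1) = 1%N :> nat by rewrite inordK.
  rewrite (big_pred1 [ffun => inord 1]) => [|T /=].
    rewrite big_pred0 // => c; by rewrite ffunE oneE.
  apply/fitsP/eqP => [[T0 _ _ _ T1]|->].
    apply/ffunP => c; apply: ord_inj; rewrite ffunE oneE.
    by apply/eqP; rewrite eqn_leq T1 T0.
  by split=> *; rewrite ?ffunE ?oneE ?mu00.
rewrite big_pred0 // => T; apply/fitsP => -[T0 _ _ Tm _]; apply: nmu0 => i.
rewrite -leqn0 leqNgt; apply/negP => mui.
have [c [rc cc]] := cell_exists (leq_trans mui (mu_le i)).
by have := Tm c; rewrite rc cc mui leqNgt T0.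
Qed.

(** * Removing the largest entry of a filling *)

Section Branching.
Variables (n m : nat) (mu1 : nat -> nat).
Hypothesis le_n : (size lam <= n)%N.
Hypothesis mN : (m.+2 <= N)%N.
Hypothesis mu1_le : forall i, (mu1 i <= nth 0 lam i)%N.
Hypothesis mu1_anti : forall i, (mu1 i.+1 <= mu1 i)%N.

Lemma mu1_anti_le i j : (i <= j)%N -> (mu1 j <= mu1 i)%N.
Proof.
by move=> /subnK <-; elim: (j - i)%N => // k IH; exact: leq_trans (mu1_anti _) IH.
Qed.

Definition has_entry_le T i j : bool :=
  [exists c, [&& row0 c == i, col0 c == j & T c <= m]%N].

(** The entries at most [m] form an initial segment of each row, so the first column without one is
    their number. *)
Definition row_length T i : nat :=
  find (fun j => ~~ has_entry_le T i j) (iota 0 (mu1 0%N)).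

Lemma has_entry_leP T i j :
  reflect (exists c, [/\ row0 c = i, col0 c = j & (T c <= m)%N]) (has_entry_le T i j).
Proof.
apply: (iffP existsP) => -[c]; first by case/and3P => /eqP rc /eqP cc Tc; exists c.
by move=> [<- <- Tc]; exists c; rewrite !eqxx.
Qed.

Lemma row_length_le T i : (row_length T i <= mu1 0%N)%N.
Proof. by rewrite -[leqRHS](size_iota 0) find_size. Qed.

Lemma lt_row_length T i j : (j < row_length T i)%N -> has_entry_le T i j.
Proof.
move=> ji; have := before_find 0%N ji; rewrite nth_iota ?add0n.
  by move/negbFE.
exact: leq_trans ji (row_length_le T i).
Qed.

Lemma ltn_row_lengthE T c : fits m.+1 mu1 T ->
  (T c <= m)%N = (col0 c < row_length T (row0 c))%N.
Proof.
case/fitsP => _ Tr _ Tm _; apply/idP/idP => [Tcm|]; last first.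
  by move/lt_row_length/has_entry_leP => [d [rd cd]]; rewrite (cell_inj rd cd).
have c_mu1 : (col0 c < mu1 (row0 c))%N by rewrite -Tm leqW.
rewrite ltnNge; apply/negP => le_c; have := le_c.
have lt_0 : (row_length T (row0 c) < mu1 0%N)%N.
  by apply: leq_ltn_trans le_c _; apply: leq_trans c_mu1 (mu1_anti_le _).
move=> _; have : has (fun j => ~~ has_entry_le T (row0 c) j) (iota 0 (mu1 0%N)).
  by rewrite has_find size_iota.
move/(nth_find 0%N)/negP; rewrite -/(row_length _ _) nth_iota // add0n; apply.
have [d [rd cd]] := cell_exists (leq_ltn_trans le_c (col0_lt c)).
apply/has_entry_leP; exists d; split=> //.
by apply: leq_trans Tcm; apply: Tr => //; rewrite cd.
Qed.

Lemma row_length_anti T i : fits m.+1 mu1 T ->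
  (row_length T i.+1 <= row_length T i)%N.
Proof.
move=> Tfits; rewrite leqNgt; apply/negP => /lt_row_length/has_entry_leP[c [rc cc Tc]].
have [d [rd cd]] : exists d, row0 d = i /\ col0 d = col0 c.
  by apply: cell_exists; apply: leq_trans (nth_part_anti i); rewrite -rc col0_lt.
have := ltn_row_lengthE d Tfits; rewrite rd cd cc ltnn.
case/fitsP: Tfits => _ _ Tcol _ _.
by rewrite (leq_trans _ Tc) //; apply: Tcol => //; rewrite rd rc.
Qed.

Lemma row_length_mu1 T i : fits m.+1 mu1 T -> (row_length T i <= mu1 i)%N.
Proof.
move=> /fitsP[_ _ _ Tm _]; rewrite leqNgt; apply/negP.
move=> /lt_row_length/has_entry_leP[c [rc cc Tc]].
by have := Tm c; rewrite rc cc ltnn leqW.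
Qed.

Definition row_lengths T : n.-tuple 'I_(mu1 0%N).+1 :=
  [tuple inord (row_length T i) | i < n].

Lemma nth_row_lengths T i : (i < n)%N ->
  nth 0%N (map val (row_lengths T)) i = row_length T i.
Proof.
move=> i_n; rewrite (nth_map ord0) ?size_tuple //.
rewrite -(tnth_nth ord0 _ (Ordinal i_n)) tnth_mktuple /= inordK //.
by rewrite ltnS row_length_le.
Qed.

Lemma is_chainP (t : seq nat) : size t = n ->
  reflect [/\ forall i, (i < n)%N -> (nth 0 t i <= mu1 i)%N
             & forall i, (i.+1 < n)%N -> (nth 0 t i.+1 <= nth 0 t i)%N]
    (is_chain mu1 t).
Proof.
move=> szt; rewrite /is_chain szt; apply: (iffP allP) => [t_chain|[t_le t_anti] i].
  split=> i i_n.
    by have := t_chain i; rewrite mem_iota add0n leq_min => /(_ i_n)/andP[].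
  by have := t_chain i.+1; rewrite mem_iota add0n leq_min => /(_ i_n)/andP[].
rewrite mem_iota add0n => /= i_n; rewrite leq_min t_le //.
case: i i_n => [|i] i_n /=; last by rewrite t_anti.
by rewrite andbT; exact: t_le.
Qed.

Lemma row_lengths_chain T : fits m.+1 mu1 T -> is_chain mu1 (map val (row_lengths T)).
Proof.
move=> Tfits; apply/is_chainP; first by rewrite size_map size_tuple.
split=> i i_n; first by rewrite nth_row_lengths // row_length_mu1.
by rewrite !nth_row_lengths ?row_length_anti // ltnW.
Qed.

Variable t : n.-tuple 'I_(mu1 0%N).+1.
Hypothesis t_chain : is_chain mu1 (map val t).
Local Notation mu0 := (nth 0%N (map val t)).

Lemma chain_le i : (mu0 i <= mu1 i)%N.
Proof.
have szt : size (map val t) = n by rewrite size_map size_tuple.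
have [i_n|ni] := ltnP i n; last by rewrite nth_default ?szt.
by have /(is_chainP szt)[t_le _] := t_chain; exact: t_le.
Qed.

Lemma chain_anti i : (mu0 i.+1 <= mu0 i)%N.
Proof.
have szt : size (map val t) = n by rewrite size_map size_tuple.
have [i_n|ni] := ltnP i.+1 n; last by rewrite nth_default ?szt.
by have /(is_chainP szt)[_ t_anti] := t_chain; exact: t_anti.
Qed.

(** This rewrites the fibre of [row_lengths] cell by cell, in the form in which [fits] prescribes
    the inner shape. *)
Lemma fits_row_lengths T :
  (fits m.+1 mu1 T && (row_lengths T == t)) =
  (fits m.+1 mu1 T && [forall c, (T c <= m)%N == (col0 c < mu0 (row0 c))%N]).
Proof.
case Tfits: (fits _ _ _) => //=; apply/eqP/forallP => [<- c|Tt].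
  rewrite (ltn_row_lengthE c Tfits) nth_row_lengths //.
  exact: leq_trans (ltn_ord _) le_n.
apply: eq_from_tnth => i; apply: ord_inj.
have tE j : nat_of_ord (tnth t j) = mu0 j.
  by rewrite (nth_map ord0) ?size_tuple // -tnth_nth.
rewrite tE tnth_mktuple inordK ?ltnS ?row_length_le //.
apply/eqP; rewrite eqn_leq; apply/andP; split; rewrite leqNgt; apply/negP => lt_i.
  have := lt_i; move/lt_row_length/has_entry_leP => [c [rc cc Tc]].
  by have := Tt c; rewrite Tc rc cc ltnn.
have [c [rc cc]] := cell_exists (leq_trans lt_i (leq_trans (chain_le i) (mu1_le i))).
have := eqP (Tt c); rewrite (ltn_row_lengthE c Tfits) rc cc ltnn lt_i.
by [].
Qed.

(** The old filler [m + 1] becomes the new entry on the cells between the shapes [mu0] and [mu1];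
    only the cells outside [mu1] get the next filler [m + 2]. *)
Definition lift_filling T : {ffun C -> 'I_N.+1} :=
  [ffun c => if (col0 c < mu1 (row0 c))%N then T c else inord m.+2].

Definition cap_filling T : {ffun C -> 'I_N.+1} :=
  [ffun c => inord (minn (T c) m.+1)].

Lemma lift_fillingE T c :
  lift_filling T c = (if (col0 c < mu1 (row0 c))%N then T c : nat else m.+2) :> nat.
Proof. by rewrite ffunE; case: ifP => // _; rewrite inordK. Qed.

Lemma cap_fillingE T c : cap_filling T c = minn (T c) m.+1 :> nat.
Proof. by rewrite ffunE inordK // ltnS geq_min (ltnW mN) orbT. Qed.

Local Notation fits2 T :=
  (fits m.+1 mu1 T && [forall c, (T c <= m)%N == (col0 c < mu0 (row0 c))%N]).

Lemma cap_fillingK T : fits2 T -> lift_filling (cap_filling T) = T.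
Proof.
case/andP => /fitsP[_ _ _ Tm Tm1] _; apply/ffunP => c; apply: ord_inj.
rewrite lift_fillingE cap_fillingE -Tm; have := Tm1 c; case: ifP; lia.
Qed.

Lemma cap_fits T : fits2 T -> fits m mu0 (cap_filling T).
Proof.
case/andP => /fitsP[T0 Tr Tc Tm Tm1] /forallP Tt; apply/fitsP.
split=> [c|c d rcd ccd|c d rcd ccd|c|c]; rewrite !cap_fillingE.
- by rewrite leq_min T0.
- by have := Tr c d rcd ccd; lia.
- by have := Tc c d rcd ccd; lia.
- by rewrite -(eqP (Tt c)); lia.
- by lia.
Qed.

Lemma lift_fits T : fits m mu0 T -> fits2 (lift_filling T).
Proof.
case/fitsP=> [T0 Tr Tc Tm Tm1]; apply/andP; split; last first.
  apply/forallP => c; rewrite lift_fillingE -Tm.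
  have := chain_le (row0 c); have := Tm c; case: ifP => //; lia.
apply/fitsP; split=> [c|c d rcd ccd|c d rcd ccd|c|c]; rewrite !lift_fillingE.
- by have := T0 c; case: ifP.
- by have := Tr c d rcd ccd; have := Tm1 c; rewrite rcd; do 2!case: ifP; lia.
- have := Tc c d rcd ccd; have := Tm1 c; rewrite rcd.
  by have := mu1_anti_le ccd; do 2!case: ifP; lia.
- by have := Tm1 c; case: ifP; lia.
- by have := Tm1 c; case: ifP; lia.
Qed.

Lemma lift_fillingK T : fits m mu0 T -> cap_filling (lift_filling T) = T.
Proof.
case/fitsP=> [_ _ _ Tm Tm1]; apply/ffunP => c; apply: ord_inj.
rewrite cap_fillingE lift_fillingE; have := Tm c; have := Tm1 c.
by have := chain_le (row0 c); case: ifP; lia.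
Qed.

Lemma weight_lift_old T c : fits m mu0 T -> (T c <= m)%N ->
  cell_weight (nat_filling (lift_filling T)) c = cell_weight (nat_filling T) c.
Proof.
move=> Tfits Tcm; have /fitsP[_ _ _ Tm Tm1] := Tfits.
have lE d : (T d <= m)%N -> lift_filling T d = T d :> nat.
  rewrite lift_fillingE Tm => d0; case: ifP => //.
  by have := chain_le (row0 d); lia.
have lE' d : ((lift_filling T d : nat) == T c) = ((T d : nat) == T c).
  have [/lE ->//|dm] := leqP (T d) m.
  rewrite lift_fillingE; case: ifP => // _; lia.
have eqT d : (nat_filling (lift_filling T) d == nat_filling (lift_filling T) c)
    = (nat_filling T d == nat_filling T c).
  by rewrite !nat_fillingE (lE c Tcm) lE'.
rewrite /cell_weight.
have -> : eq_above (nat_filling (lift_filling T)) c = eq_above (nat_filling T) c.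
  by apply: eq_existsb => d; rewrite eqT.
have -> : eq_right (nat_filling (lift_filling T)) c = eq_right (nat_filling T) c.
  by apply: eq_existsb => d; rewrite eqT.
by rewrite !nat_fillingE lE.
Qed.

(** The value [m + 1] fills exactly the cells between [mu0] and [mu1], so equality with a neighbour
    is a condition on columns. The prepended [mu1 0] makes every such cell of the top row receive
    [x]. *)
Lemma weight_lift_new T c : fits m mu0 T ->
  (mu0 (row0 c) <= col0 c < mu1 (row0 c))%N ->
  cell_weight (nat_filling (lift_filling T)) c =
  (if (col0 c < nth 0%N (mu1 0%N :: map val t) (row0 c))%N then x m.+1 else b (row0 c))
  - (if ((col0 c).+1 < mu1 (row0 c))%N then a (col0 c).+1 else 0).
Proof.
move=> Tfits /andP[c0 c1]; have /fitsP[_ _ _ Tm Tm1] := Tfits.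
have lE d : (nat_filling (lift_filling T) d == m.+1) =
    (mu0 (row0 d) <= col0 d < mu1 (row0 d))%N.
  rewrite nat_fillingE lift_fillingE; have := Tm d; have := Tm1 d.
  by have := chain_le (row0 d); case: ifP; lia.
have cE : nat_filling (lift_filling T) c = m.+1.
  by apply/eqP; rewrite lE c0 c1.
rewrite /cell_weight cE; congr (_ - _).
  have -> : eq_above (nat_filling (lift_filling T)) c =
      ~~ (col0 c < nth 0%N (mu1 0%N :: map val t) (row0 c))%N.
    apply/eq_aboveP/idP => [[d [rd cd]]|].
      rewrite cE => /eqP; rewrite lE -rd cd => /andP[d0 _].
      by rewrite -leqNgt.
    case E: (row0 c) => [|i] /=; first by rewrite E in c1; rewrite c1.
    rewrite -leqNgt => i0.
    have i1 : (col0 c < mu1 i)%N by apply: leq_trans c1 _; rewrite E.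
    have [d [rd cd]] := cell_exists (leq_trans i1 (mu1_le i)).
    exists d; rewrite rd cd; split=> //; apply/eqP.
    by rewrite cE lE rd cd i0.
  by case: (col0 c < _)%N.
have -> : eq_right (nat_filling (lift_filling T)) c = ((col0 c).+1 < mu1 (row0 c))%N.
  apply/eq_rightP/idP => [[d [rd cd]]|i1].
    by rewrite cE => /eqP; rewrite lE rd cd => /andP[_].
  have [d [rd cd]] := cell_exists (leq_trans i1 (mu1_le _)).
  by exists d; split=> //; apply/eqP; rewrite cE lE rd cd i1 leqW.
by [].
Qed.

Lemma prod_lift T : fits m mu0 T ->
  \prod_(c | (lift_filling T c <= m.+1)%N) cell_weight (nat_filling (lift_filling T)) c =
  chain_weight (x m.+1) a b mu1 (map val t) *
  \prod_(c | (T c <= m)%N) cell_weight (nat_filling T) c.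
Proof.
move=> Tfits; have /fitsP[_ _ _ Tm Tm1] := Tfits.
rewrite (bigID (fun c => (T c <= m)%N)) /= mulrC; congr (_ * _).
  rewrite (eq_bigl (fun c => (mu0 (row0 c) <= col0 c < mu1 (row0 c))%N)); last first.
    move=> c; rewrite lift_fillingE Tm -leqNgt andbC; congr (_ && _).
    by case: ifP => _; [exact: Tm1 | rewrite ltnn].

  under eq_bigr => c cnew do rewrite (weight_lift_new Tfits cnew).
  rewrite (@prod_cells n mu0 mu1 (fun i j =>
    (if (j < nth 0%N (mu1 0%N :: map val t) i)%N then x m.+1 else b i)
    - (if (j.+1 < mu1 i)%N then a j.+1 else 0))) //.
  by rewrite /chain_weight size_map size_tuple.
apply: eq_big => c; last by case/andP => _; exact: weight_lift_old.
rewrite lift_fillingE Tm; case: ifP => [_|c1]; first by rewrite Tm1.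
rewrite ltnn; apply/esym/negP => c0.
by rewrite (leq_trans c0 (chain_le _)) in c1.
Qed.

Lemma filling_sum_row_lengths :
  \sum_(T | fits m.+1 mu1 T && (row_lengths T == t))
     \prod_(c | (T c <= m.+1)%N) cell_weight (nat_filling T) c =
  chain_weight (x m.+1) a b mu1 (map val t) * filling_sum m mu0.
Proof.
under eq_bigl do rewrite fits_row_lengths.
rewrite (reindex_onto lift_filling cap_filling); last exact: cap_fillingK.
rewrite /filling_sum mulr_sumr; apply: eq_big => T.
  apply/andP/idP => [[/cap_fits Tfits /eqP TE]|Tfits]; first by rewrite TE in Tfits.
  by rewrite lift_fits // lift_fillingK.
case/andP => /cap_fits Tfits /eqP TE; rewrite TE in Tfits.
exact: prod_lift.
Qed.

End Branching.

Lemma filling_sum_branching n m mu1 : (size lam <= n)%N -> (m.+2 <= N)%N ->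
  (forall i, mu1 i <= nth 0 lam i)%N -> (forall i, mu1 i.+1 <= mu1 i)%N ->
  filling_sum m.+1 mu1 =
  \sum_(t : n.-tuple 'I_(mu1 0%N).+1 | is_chain mu1 (map val t))
     chain_weight (x m.+1) a b mu1 (map val t) * filling_sum m (nth 0%N (map val t)).
Proof.
move=> le_n mN mu1_le mu1_anti.
rewrite /filling_sum (partition_big (row_lengths n m mu1)
  (fun t => is_chain mu1 (map val t))); last by move=> T; exact: row_lengths_chain.
by apply: eq_bigr => t; exact: filling_sum_row_lengths.
Qed.

Lemma filling_sumE n m mu : a 0%N = 0 -> (size lam <= n)%N -> (m < N)%N ->
  (forall i, mu i <= nth 0 lam i)%N -> (forall i, mu i.+1 <= mu i)%N ->
  filling_sum m mu = jacobi_trudi n a b (map x (iota 1 m)) mu.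
Proof.
move=> a0 le_n; elim: m mu => [|m IH] mu mN mu_le mu_anti.
  by rewrite (filling_sum0 le_n) // jacobi_trudi_nil.
rewrite (filling_sum_branching le_n) //.
(* The branching rule adds the variable in front, [iota] at the end. *)
rewrite (@jacobi_trudi_perm _ _ _ _ _ (x m.+1 :: map x (iota 1 m))); last first.
  by rewrite -[in iota 1 m.+1](addn1 m) iotaD map_cat perm_catC add1n.
have mu_le0 i : (mu i < (mu 0%N).+1)%N.
  by rewrite ltnS; elim: i => // i; exact: leq_trans (mu_anti i).
rewrite jacobi_trudi_branching // (chain_sum_tuple _ _ _ _ _ mu_le0).
apply: eq_bigr => t t_chain; rewrite IH ?(ltnW mN) // => i.
  by apply: leq_trans (mu_le i); exact: chain_le.
exact: (chain_anti t_chain).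
Qed.

End Fillings.

(** * Marked fillings with bounded entries *)

Section BoundedMarkedFillings.
Variable lam : seq nat.
Local Notation C := (cell lam).

Definition bounded (n : nat) (T : mrpp lam) : bool := [forall c, (val T).1 c <= n]%N.

(** The type of entries includes [n + 1], to agree with [filling_sum], which needs room for the
    filler; the filter then excludes it. *)
Definition bounded_mrpps (n : nat) : seq (mrpp lam) :=
  [seq T <- pmap (fun p : {ffun C -> 'I_n.+2} * {set C} =>
                    insub (nat_filling p.1, p.2) : option (mrpp lam))
                 (enum {: {ffun C -> 'I_n.+2} * {set C}}) | bounded n T].

Lemma bounded_mrpps_uniq n : uniq (bounded_mrpps n).
Proof.
apply: filter_uniq.
pose g (T : mrpp lam) : {ffun C -> 'I_n.+2} * {set C} :=
  ([ffun c => inord ((val T).1 c)], (val T).2).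
apply: (@pmap_uniq _ _ _ g); last exact: enum_uniq.
move=> [F S] /=; case: insubP => [T _ TE|//].
suff : g T = (F, S) by move=> <-.
rewrite /g TE /=; congr (_, _); apply/ffunP => c; rewrite ffunE nat_fillingE.
exact: inord_val.
Qed.

Lemma mem_bounded_mrpps n T : (T \in bounded_mrpps n) = bounded n T.
Proof.
rewrite mem_filter; case Tn: (bounded n T) => //=.
rewrite mem_pmap; apply/mapP.
exists ([ffun c => inord ((val T).1 c)], (val T).2); first by rewrite mem_enum.
have -> : (nat_filling [ffun c => inord ((val T).1 c) : 'I_n.+2], (val T).2) = val T.
  rewrite [RHS]surjective_pairing; congr (_, _); apply/ffunP => c.
  rewrite nat_fillingE ffunE inordK //.
  by have /forallP/(_ c) := Tn; rewrite ltnS => /leqW.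
by rewrite /= valK.
Qed.

Variables (K : comNzRingType) (x a b : nat -> K).

Definition mark_weight (F : {ffun C -> nat}) (S : {set C}) c : K :=
  if c \in S then - a (col0 c).+1
  else if eq_above F c then b (row0 c) else x (F c).

(** Distributing the product, [S] is the set of cells where the second term is chosen; a cell of [S]
    that may not be marked contributes the factor [0]. *)
Lemma sum_marks (F : {ffun C -> nat}) :
  \prod_c cell_weight x a b F c =
  \sum_(S : {set C} | [forall c in S, eq_right F c]) \prod_c mark_weight F S c.
Proof.
rewrite /cell_weight; under eq_bigr => c _ do rewrite addrC.
rewrite bigA_distr [RHS]big_mkcond; apply: eq_bigr => S _.
case: ifPn => [/forall_inP SF|].
  by apply: eq_bigr => c _; rewrite /mark_weight; case: ifP => // /SF ->.
rewrite negb_forall_in => /exists_inP[c cS /negbTE cF].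
by rewrite (bigD1 c) //= cS cF oppr0 mul0r.
Qed.

Lemma sum_bounded_mrpps n :
  \sum_(T <- bounded_mrpps n) \prod_c mark_weight (val T).1 (val T).2 c =
  filling_sum lam x a b n.+1 n (nth 0%N lam).
Proof.
have fitsE (F : {ffun C -> 'I_n.+2}) :
    fits n (nth 0%N lam) F = is_rpp (nat_filling F) && [forall c, nat_filling F c <= n]%N.
  rewrite /fits; congr (_ && _); apply/andP/forallP => [[/forallP Fn _] c|Fn].
    by rewrite nat_fillingE (eqP (Fn c)) col0_lt.
  split; apply/forallP => c; have := Fn c; rewrite nat_fillingE.
    by move=> ->; rewrite col0_lt.
  by move/leqW.
rewrite /filling_sum (eq_bigl _ _ fitsE).
under [RHS]eq_bigr => F /andP[_ /forallP Fn].
  rewrite (eq_bigl xpredT) => [|c]; last by have := Fn c; rewrite nat_fillingE.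
  rewrite sum_marks; over.
rewrite pair_big_dep /= /bounded_mrpps big_filter big_mkcond big_pmap big_enum /=.
rewrite [RHS]big_mkcond.
apply: eq_bigr => -[F S] _ /=; case: insubP => [T /andP[/= rppF SF] TE|/=].
  by rewrite rppF SF andbT /bounded -[val T]/(sval T) TE.
by case: (is_rpp _) => //= /negbTE ->; rewrite andbF.
Qed.

End BoundedMarkedFillings.

(** * The series *)

Lemma eq_big_seq_support (R : nmodType) (I : eqType) (s s' : seq I) (F : I -> R) :
  uniq s -> uniq s' -> (forall i, F i != 0 -> i \in s) ->
  (forall i, F i != 0 -> i \in s') -> \sum_(i <- s) F i = \sum_(i <- s') F i.
Proof.
move=> us us' sF s'F.
have drop0 r : \sum_(i <- r) F i = \sum_(i <- [seq i <- r | F i != 0]) F i.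
  rewrite big_filter [RHS]big_mkcond; apply: eq_bigr => i _.
  by case: eqP.
rewrite drop0 [RHS]drop0; apply: perm_big; apply: uniq_perm; rewrite ?filter_uniq //.
by move=> i; rewrite !mem_filter; case Fi: (F i != 0); rewrite //= sF ?s'F.
Qed.

Section Weights.
Variable lam : seq nat.
Implicit Types (T : mrpp lam) (m : {cmonom nat}).

Definition bounded_sum (n : nat) : polring := \sum_(T <- bounded_mrpps lam n) wt T.

Lemma wtE T :
  wt T = \prod_c mark_weight (fun k => var (xi k)) al_seq be_seq (val T).1 (val T).2 c.
Proof. by []. Qed.

(* The rightmost cell of the top row of the region with a given entry is neither
   marked nor equal to the cell above it. *)
Lemma exists_x_weight T (c0 : cell lam) :
  exists c, wt_cell T c = var (xi ((val T).1 c0)).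
Proof.
pose F := (val T).1; pose h := head 0%N lam.
have h_gt (c : cell lam) : (col0 c < h)%N by exact: (ltn_ord (val c).2).
(* As columns are less than [h], this orders the cells by row from the top, then by column from the
   right. *)
pose rank (c : cell lam) := (row0 c * h + (h - col0 c))%N.
case: (@arg_minnP _ c0 (fun c => F c == F c0) rank (eqxx _)) => c /eqP Fc rank_min.
exists c; rewrite /wt_cell.
have /andP[_ /forall_inP marks] := valP T.
case: ifPn => [/marks/eq_rightP[d [rd cd Fd]]|_].
  have := rank_min d; rewrite {1}/F Fd -/F Fc eqxx => /(_ isT).
  by rewrite /rank rd cd; have := h_gt c; lia.
case: ifPn => [/eq_aboveP[d [rd cd Fd]]|_]; last by rewrite -/F Fc.
have := rank_min d; rewrite {1}/F Fd -/F Fc eqxx => /(_ isT).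
by rewrite /rank -rd cd mulSn; have := h_gt c; lia.
Qed.

Lemma wt_coef_eq0 T c m : m ((val T).1 c).-1 = 0%N -> (wt T)@_m = 0.
Proof.
have [d wd] := exists_x_weight T c.
rewrite /wt (bigD1 d) // wd.
exact: (var_divides_mul _ (@var_divides_xi _ _)).
Qed.

(** Each entry of [T] contributes its variable to the weight. Hence only finitely many [T] meet a
    given monomial, as [is_fps_sum] demands. *)
Lemma bounded_coef n T m : (forall i, (n <= i)%N -> m i = 0%N) ->
  (wt T)@_m != 0 -> bounded n T.
Proof.
move=> mn; apply: contraR; rewrite negb_forall => /existsP[c]; rewrite -ltnNge => nc.
by rewrite (@wt_coef_eq0 _ c) // mn //; lia.
Qed.

Lemma wt_vars_below n T : bounded n T -> vars_below n (wt T).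
Proof.
move=> /forallP Tn; apply: vars_below_prod => c; rewrite /wt_cell.
case: ifP => _; first exact/vars_below_N/vars_below_C.
case: ifP => _; first exact: vars_below_C.
apply: vars_below_xi; rewrite Tn andbT.
have /andP[/and3P[/forallP T0 _ _] _] := valP T; exact: T0.
Qed.

Lemma bounded_sum_coef n m :
  (bounded_sum n)@_m = \sum_(T <- bounded_mrpps lam n) (wt T)@_m.
Proof. exact: raddf_sum. Qed.

Lemma bounded_sum_coef_eq n n' m : (forall i, (n <= i)%N -> m i = 0%N) ->
  (forall i, (n' <= i)%N -> m i = 0%N) ->
  (bounded_sum n)@_m = (bounded_sum n')@_m.
Proof.
move=> mn mn'; rewrite !bounded_sum_coef.
by apply: eq_big_seq_support; rewrite ?bounded_mrpps_uniq // => T wT;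
  rewrite mem_bounded_mrpps; apply: bounded_coef wT.
Qed.

Lemma bounded_sum_coef_eq0 n m i : (n <= i)%N -> m i != 0%N -> (bounded_sum n)@_m = 0.
Proof.
move=> ni mi; rewrite bounded_sum_coef big_seq big1 // => T.
by rewrite mem_bounded_mrpps => /wt_vars_below/(_ m i ni mi).
Qed.

Lemma bounded_sum_is_g n : is_part lam -> (size lam <= n)%N ->
  is_g_poly lam n (bounded_sum n).
Proof.
move=> lam_part le_n.
have sumE : bounded_sum n * g_den n = g_num lam n.
  rewrite g_numE; congr (_ * _); rewrite /bounded_sum.
  rewrite (eq_bigr _ (fun T _ => wtE T)) sum_bounded_mrpps.
  have xsE : [seq var (xi k) | k <- iota 1 n] =
      [seq var (xi (val j).+1) | j <- enum 'I_n].
    by rewrite -[in iota 1 n](addn0 1%N) iotaDl -val_enum_ord -!map_comp.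
  rewrite -xsE; apply: (filling_sumE lam_part (fun k => var (xi k)) be_seq
    (erefl : al_seq 0 = 0) le_n (ltnSn n) (fun=> leqnn _)).
  exact: nth_part_anti.
split=> // q; rewrite -{}sumE ![_ * g_den n]mulrC => /esym.
exact: g_den_lreg.
Qed.

Definition monomial_bound m : nat := \max_(k <- finsupp m) k.+1.

Lemma monomial_boundP m i : (monomial_bound m <= i)%N -> m i = 0%N.
Proof.
apply: contraTeq; rewrite cmE_neq0 -ltnNge => im.
by rewrite /monomial_bound; apply: (leq_bigmax_seq (F := succn) i im).
Qed.

(** Any bound beyond the variables of [m] gives the same coefficient, by [bounded_sum_coef_eq]. *)
Definition mrpp_series : fps := fun m => (bounded_sum (monomial_bound m))@_m.

Lemma mrpp_series_is_g : is_part lam -> is_g_series lam mrpp_series.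
Proof.
move=> lam_part n le_n; exists (bounded_sum n); first exact: bounded_sum_is_g.
move=> m; rewrite /fps_trunc /fps_of /mrpp_series; case: allP => [mn|/allP].
  apply: bounded_sum_coef_eq => i; first exact: monomial_boundP.
  by apply: contraTeq; rewrite cmE_neq0 -ltnNge; exact: mn.
rewrite -has_predC => /hasP[i im] /=; rewrite -leqNgt => ni.
by rewrite (bounded_sum_coef_eq0 ni) // cmE_neq0.
Qed.

End Weights.

(** Each coefficient survives in a truncation with [n] large, where the quotient is unique. *)
Lemma is_g_series_unique lam (G G' : fps) :
  is_g_series lam G -> is_g_series lam G' -> G = G'.
Proof.
move=> Gg G'g; apply: functional_extensionality => m.
pose n := maxn (size lam) (monomial_bound m).
have mn : all (fun k => (k < n)%N) (finsupp m).
  apply/allP => k; rewrite -cmE_neq0; apply: contraTT; rewrite -leqNgt => nk.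
  rewrite negbK monomial_boundP //; apply: leq_trans nk; exact: leq_maxr.
have [g [_ g_unique] /(_ m)] := Gg n (leq_maxl _ _).
have [g' [g'P _] /(_ m)] := G'g n (leq_maxl _ _).
by rewrite /fps_trunc mn (g_unique _ g'P) => -> ->.
Qed.

Theorem theorem4p2 (lam : seq nat) (lam_part : is_part lam) :
  exists G : fps,
    unique (is_g_series lam) G /\
    is_fps_sum (fun T : mrpp lam => fps_of (wt T)) G.
Proof.
exists (mrpp_series lam); split.
  split; first exact: mrpp_series_is_g.
  by move=> G; apply: is_g_series_unique; exact: mrpp_series_is_g.
move=> m; exists (bounded_mrpps lam (monomial_bound m)); split.
- exact: bounded_mrpps_uniq.
- move=> T; rewrite mem_bounded_mrpps; apply: bounded_coef => i.
  exact: monomial_boundP.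
- exact: bounded_sum_coef.
Qed.
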